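(* Let $S=\mathbb R^d\times\mathbb R^+$ be an $ax+b$-group. For all $p\in[1,\infty)$, $BMO_p=BMO_1$, and the norms $\|\cdot\|_{BMO_p}$ and $\|\cdot\|_{BMO_1}$ are equivalent.
   Context: **$ax+b$-groups.** $S=\mathbb R^d\times\mathbb R^+$ ($d\ge1$) with product $(x,a)(x',a')=(x+a^{1/2}x',aa')$ and right Haar measure $d\rho(x,a)=a^{-1}\,dx\,da$. **Admissible sets.** For $k\in\mathbb Z$, $m\in\mathbb Z^d$ let $Q^k_m=\prod_{i=1}^d(m_i2^k,(m_i+1)2^k)$. Fix a constant $\beta>1+\log2$. A set $Q^k_m\times(a_0/r,a_0r)$, $a_0>0$, $r>1$, is admissible if $a_0^{1/2}r^\beta\le2^k<a_0^{1/2}r^{4\beta}$ when $r\ge\mathrm e$, and $a_0^{1/2}\log r\le2^k<\mathrm e^{4\beta}a_0^{1/2}\log r$ when $1<r<\mathrm e$. **BMO spaces.** For $1\le p<\infty$, $BMO_p$ is the space of all $f\in L^p_{\rm loc}(\rho)$ such that $$\|f\|_{BMO_p}=\sup_R\Big(\frac1{\rho(R)}\int_R|f-f_R|^p\,d\rho\Big)^{1/p}<\infty,\qquad f_R=\frac1{\rho(R)}\int_Rf\,d\rho,$$ the supremum being over all admissible sets $R$, modulo constant functions. *)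

(* Defs.v *)
From HB Require Import structures.
From mathcomp Require Import all_boot all_order all_algebra.
From mathcomp Require Import all_classical all_reals all_analysis.
From mathcomp Require Import measurable_realfun complex.

Set Implicit Arguments.
Unset Strict Implicit.
Unset Printing Implicit Defensive.

Import Order.TTheory GRing.Theory Num.Theory.
Import numFieldNormedType.Exports.

Local Open Scope classical_set_scope.
Local Open Scope ring_scope.
Local Open Scope complex_scope.
Local Open Scope quotient_scope.

(* The Borel sigma-algebra of R^n, generated by the coordinate functions. *)
Section measurable_rV.
Context {R : realType} {n : nat}.

Let coord (i : 'I_n) (x : 'rV[R]_n) : R := x ord0 i.

Let rV_set0 : g_sigma_preimage coord set0.
Proof. exact: sigma_algebra0. Qed.

Let rV_setC A : g_sigma_preimage coord A -> g_sigma_preimage coord (~` A).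
Proof. exact: sigma_algebraC. Qed.

Let rV_bigcup (F : (set 'rV[R]_n)^nat) :
  (forall i, g_sigma_preimage coord (F i)) ->
  g_sigma_preimage coord (\bigcup_i (F i)).
Proof. exact: sigma_algebra_bigcup. Qed.

HB.instance Definition _ := @isMeasurable.Build default_measure_display
  'rV[R]_n (g_sigma_preimage coord) rV_set0 rV_setC rV_bigcup.

Lemma measurable_coord (i : 'I_n) :
  measurable_fun [set: 'rV[R]_n] (fun x : 'rV[R]_n => x ord0 i : R).
Proof.
move=> _ Y mY; rewrite setTI; apply: sub_sigma_algebra => /=.
rewrite -bigcup_seq/=; exists i => /=; first by rewrite mem_index_enum.
by exists Y => //; rewrite setTI.
Qed.

Lemma measurable_fun_rV d (T : measurableType d) (f : T -> 'rV[R]_n) :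
  (forall i, measurable_fun [set: T] (fun t => f t ord0 i : R)) ->
  measurable_fun [set: T] f.
Proof.
move=> mf; have : g_sigma_preimage (fun i => coord i \o f) `<=` measurable.
  apply: smallest_sub; first exact: sigma_algebra_measurable.
  rewrite -bigcup_seq => A [i _ [B mB <-]].
  exact: (mf i).
rewrite g_sigma_preimage_comp => sub _ A mA.
by apply: sub; exists A.
Qed.

End measurable_rV.

(* lebesgue_measure, whose domain is the copy measurableTypeR R of R, as a
   measure on R itself. *)
Section lebesgue_R.
Context {R : realType}.
Local Open Scope ereal_scope.

Definition lebesgue_R : set R -> \bar R := @lebesgue_measure R.

Let leb0 : lebesgue_R set0 = 0.
Proof. exact: (measure0 (@lebesgue_measure R)). Qed.

Let leb_ge0 A : 0 <= lebesgue_R A.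
Proof. exact: (measure_ge0 (@lebesgue_measure R)). Qed.

Let leb_sigma_additive : semi_sigma_additive lebesgue_R.
Proof. exact: (@measure_semi_sigma_additive _ _ _ (@lebesgue_measure R)). Qed.

HB.instance Definition _ := isMeasure.Build _ _ _ lebesgue_R
  leb0 leb_ge0 leb_sigma_additive.

Let leb_sigma_finite : sigma_finite setT lebesgue_R.
Proof. exact: (sigma_finiteT (@lebesgue_measure R)). Qed.

HB.instance Definition _ := @Measure_isSigmaFinite.Build _ _ _ lebesgue_R
  leb_sigma_finite.

End lebesgue_R.

(* Lebesgue measure on R^n, as an iterated product of the one on R. *)
Section lebesgue_rV.
Context {R : realType}.

Definition rVcons n (z : R * 'rV[R]_n) : 'rV[R]_n.+1 :=
  \row_(i < n.+1) if unlift ord0 i is Some j then z.2 ord0 j else z.1.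

Definition rVuncons n (x : 'rV[R]_n.+1) : R * 'rV[R]_n :=
  (x ord0 ord0, \row_(j < n) x ord0 (lift ord0 j)).

Lemma rVconsK n : cancel (@rVcons n) (@rVuncons n).
Proof.
case=> a x; congr pair; rewrite /rVcons ?mxE ?unlift_none//.
by apply/rowP => j; rewrite !mxE liftK.
Qed.

Lemma measurable_rVcons n : measurable_fun setT (@rVcons n).
Proof.
apply: measurable_fun_rV => i; rewrite /rVcons.
under eq_fun do rewrite mxE.
case: (unliftP ord0 i) => [j _|_].
  exact: (measurableT_comp (measurable_coord j) measurable_snd).
exact: measurable_fst.
Qed.

Lemma measurable_rVuncons n : measurable_fun setT (@rVuncons n).
Proof.
apply/measurable_fun_pair => /=; first exact: measurable_coord.
apply: measurable_fun_rV => i.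
under eq_fun do rewrite mxE.
exact: measurable_coord.
Qed.

Local Open Scope ereal_scope.

Section lebesgue_rVS.
Context n (m : {sigma_finite_measure set 'rV[R]_n -> \bar R}).

Let mxm : {measure set (R * 'rV[R]_n)%type -> \bar R} :=
  @lebesgue_R R \x m.

Definition lebesgue_rVS : set 'rV[R]_n.+1 -> \bar R :=
  pushforward mxm (@rVcons n).

Let rVS0 : lebesgue_rVS set0 = 0.
Proof. by rewrite /lebesgue_rVS /pushforward preimage_set0 measure0. Qed.

Let rVS_ge0 A : 0 <= lebesgue_rVS A.
Proof. exact: (measure_ge0 mxm). Qed.

Let rVS_sigma_additive : semi_sigma_additive lebesgue_rVS.
Proof.
move=> F mF tF mUF; rewrite /lebesgue_rVS /pushforward preimage_bigcup.
have mpre A : measurable A -> measurable (@rVcons n @^-1` A).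
  by move=> mA; rewrite -[X in measurable X]setTI; exact: measurable_rVcons.
apply: (@measure_semi_sigma_additive _ _ _ mxm) => [i||].
- exact: mpre.
- apply/trivIsetP => i j _ _ ij; rewrite -preimage_setI.
  by move/trivIsetP : tF => /(_ _ _ I I ij) ->; rewrite preimage_set0.
- by rewrite -preimage_bigcup; exact: mpre.
Qed.

HB.instance Definition _ := isMeasure.Build _ _ _ lebesgue_rVS
  rVS0 rVS_ge0 rVS_sigma_additive.

Let rVS_sigma_finite : sigma_finite setT lebesgue_rVS.
Proof.
have /sigma_finiteP[F [TF ndF Foo]] := sigma_finiteT (@lebesgue_R R).
have /sigma_finiteP[G [TG ndG Goo]] := sigma_finiteT m.
exists (fun k => @rVuncons n @^-1` (F k `*` G k)).
  rewrite -preimage_bigcup (_ : \bigcup_k _ = setT) ?preimage_setT//.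
  apply/seteqP; split => // -[x y] _.
  have [i _ Fx] : (\bigcup_k F k) x by rewrite -TF.
  have [j _ Gy] : (\bigcup_k G k) y by rewrite -TG.
  exists (maxn i j) => //; split => /=.
    by move: x Fx; exact/subsetPset/ndF/leq_maxl.
  by move: y Gy; exact/subsetPset/ndG/leq_maxr.
move=> k; have [mFk Fkoo] := Foo k; have [mGk Gkoo] := Goo k; split.
  rewrite -[X in measurable X]setTI; apply: measurable_rVuncons => //.
  exact: measurableX.
rewrite /lebesgue_rVS /pushforward.
have -> : @rVcons n @^-1` (@rVuncons n @^-1` (F k `*` G k)) = F k `*` G k.
  rewrite -comp_preimage (_ : _ \o _ = id) ?preimage_id//.
  exact/funext/rVconsK.
by rewrite [ltLHS]product_measure1E// lte_mul_pinfty// ge0_fin_numE.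
Qed.

HB.instance Definition _ := @Measure_isSigmaFinite.Build _ _ _ lebesgue_rVS
  rVS_sigma_finite.

End lebesgue_rVS.

Definition dirac_rV0 : set 'rV[R]_0 -> \bar R := dirac (0%R : 'rV[R]_0).

HB.instance Definition _ := Measure.on dirac_rV0.

Let dirac_rV0_sigma_finite : sigma_finite setT dirac_rV0.
Proof.
exists (fun=> setT); first by rewrite bigcup_const.
by move=> k; split => //; rewrite /dirac_rV0 diracT ltry.
Qed.

HB.instance Definition _ := @Measure_isSigmaFinite.Build _ _ _ dirac_rV0
  dirac_rV0_sigma_finite.

Fixpoint lebesgue_rV n : {sigma_finite_measure set 'rV[R]_n -> \bar R} :=
  match n with
  | 0 => dirac_rV0
  | n'.+1 => lebesgue_rVS (lebesgue_rV n')
  end.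

End lebesgue_rV.
Arguments lebesgue_rV {R} n.

Section axb_group.
Context {R : realType} {d : nat}.
Implicit Types (f : 'rV[R]_d * R -> R[i]) (A K : set ('rV[R]_d * R)).

(* The group S = R^d x R^+ as a subset of R^d x R; the values of functions
   outside axb are irrelevant throughout. *)
Definition axb : set ('rV[R]_d * R) := [set z | 0 < z.2].

(* a^-1 dx da, the right Haar measure for the product
   (x, a)(x', a') = (x + a^(1/2) x', a a'). *)
Definition right_haar : set ('rV[R]_d * R) -> \bar R := fun A =>
  (\int[lebesgue_rV d \x lebesgue_R]_(z in A `&` axb) (z.2^-1)%:E)%E.

Lemma measurable_axb : measurable axb.
Proof.
rewrite (_ : axb = setT `*` `]0, +oo[); last first.
  by apply/seteqP; split => z /=; rewrite in_itv/= andbT// => -[].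
exact: measurableX.
Qed.

Lemma measurable_invr2 :
  measurable_fun axb (fun z : 'rV[R]_d * R => z.2^-1).
Proof.
apply: (@measurable_comp _ _ _ (_ * _)%type R R `]0, +oo[%classic GRing.inv) => //.
- by move=> _ [z z0 <-] /=; rewrite in_itv/= andbT.
- apply: open_continuous_measurable_fun => [|x]; first exact: interval_open.
  rewrite inE/= in_itv/= andbT => x0.
  by apply: inv_continuous; rewrite gt_eqF.
- exact: measurable_funTS.
Qed.

Local Open Scope ereal_scope.

Let right_haar0 : right_haar set0 = 0.
Proof. by rewrite /right_haar set0I integral_set0. Qed.

Let right_haar_ge0 A : 0 <= right_haar A.
Proof.
by apply: integral_ge0 => z [_ /ltW z0]; rewrite lee_fin invr_ge0.
Qed.

Let right_haar_sigma_additive : semi_sigma_additive right_haar.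
Proof.
move=> F mF tF mUF; rewrite /right_haar setI_bigcupl ge0_integral_bigcup//=.
- apply: is_cvg_ereal_nneg_natsum_cond => n _ _; exact: right_haar_ge0.
- by move=> k; apply: measurableI => //; exact: measurable_axb.
- apply/measurable_EFinP; apply: measurable_funS measurable_invr2.
    exact: measurable_axb.
  by move=> z [k _ []].
- by move=> z [k _ [_ /ltW z0]]; rewrite lee_fin invr_ge0.
- apply/trivIsetP => i j _ _ ij; rewrite setIACA setIid.
  by move/trivIsetP : tF => /(_ _ _ I I ij) ->; rewrite set0I.
Qed.

HB.instance Definition _ := isMeasure.Build _ _ _ right_haar
  right_haar0 right_haar_ge0 right_haar_sigma_additive.

Local Close Scope ereal_scope.

Definition cube (k : int) (m : 'I_d -> int) : set 'rV[R]_d :=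
  [set x | forall i,
    (m i)%:~R * 2 ^ k < x ord0 i < ((m i)%:~R + 1) * 2 ^ k].

Definition admissible (beta : R) A : Prop :=
  exists (k : int) (m : 'I_d -> int) (a0 r : R),
    [/\ 0 < a0, 1 < r, A = cube k m `*` `]a0 / r, a0 * r[ &
      if expR 1 <= r
      then Num.sqrt a0 * r `^ beta <= 2 ^ k < Num.sqrt a0 * r `^ (4 * beta)
      else Num.sqrt a0 * ln r <= 2 ^ k
             < expR (4 * beta) * Num.sqrt a0 * ln r].

Definition measurable_cplx f : Prop :=
  measurable_fun axb (fun z => complex.Re (f z)) /\
  measurable_fun axb (fun z => complex.Im (f z)).

Definition Lp_loc (p : R) f : Prop :=
  measurable_cplx f /\
  forall K, K `<=` axb -> compact K ->
    (\int[right_haar]_(z in K) (Normc.normc (f z) `^ p)%:E < +oo)%E.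

Definition average f A : R[i] :=
  ((fine (right_haar A))^-1 * \int[right_haar]_(z in A) complex.Re (f z))
  +i* ((fine (right_haar A))^-1 * \int[right_haar]_(z in A) complex.Im (f z)).

Definition oscillation (p : R) f A : \bar R :=
  ((((fine (right_haar A))^-1)%:E *
    \int[right_haar]_(z in A) (Normc.normc (f z - average f A) `^ p)%:E)
   `^ p^-1)%E.

Definition bmo_seminorm (beta p : R) f : \bar R :=
  ereal_sup [set oscillation p f A | A in admissible beta].

Definition mfun_axb := {f : 'rV[R]_d * R -> R[i] | `[< measurable_cplx f >]}.
HB.instance Definition _ := Choice.on mfun_axb.

Definition eq_mod_cst (f g : mfun_axb) : bool :=
  `[< exists c : R[i],
        {ae right_haar, forall z, axb z -> sval f z = sval g z + c} >].

Let eq_mod_cst_refl : reflexive eq_mod_cst.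
Proof.
by move=> f; apply/asboolP; exists 0; apply: aeW => z _; rewrite addr0.
Qed.

Let eq_mod_cst_sym : symmetric eq_mod_cst.
Proof.
suff H (f g : mfun_axb) : eq_mod_cst f g -> eq_mod_cst g f.
  by move=> f g; apply/idP/idP; exact: H.
move=> /asboolP[c fg]; apply/asboolP; exists (- c).
by apply: filterS fg => z fg z0; rewrite fg// addrK.
Qed.

Let eq_mod_cst_trans : transitive eq_mod_cst.
Proof.
move=> g f h /asboolP[c fg] /asboolP[c' gh]; apply/asboolP; exists (c' + c).
by apply: filterS2 fg gh => z fg gh z0; rewrite fg// gh// addrA.
Qed.

Canonical eq_mod_cst_equiv :=
  EquivRel eq_mod_cst eq_mod_cst_refl eq_mod_cst_sym eq_mod_cst_trans.

(* Measurable functions modulo a.e. equality and modulo constants. *)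
Definition mfun_mod_cst : Type := {eq_quot eq_mod_cst}.
HB.instance Definition _ := Choice.on mfun_mod_cst.
HB.instance Definition _ := EqQuotient.on mfun_mod_cst.

(* Membership in Lp_loc does not depend on the representative chosen by repr,
   nor does bmo_seminorm for classes in Lp_loc, p >= 1. *)
Definition bmo_norm (beta p : R) (F : mfun_mod_cst) : \bar R :=
  bmo_seminorm beta p (sval (repr F)).

Definition BMO (beta p : R) : set mfun_mod_cst :=
  [set F | Lp_loc p (sval (repr F)) /\ (bmo_norm beta p F < +oo)%E].

End axb_group.
Arguments BMO {R} d beta p.

(* Main.v *)
(* Each admissible set splits into finitely many admissible sets of at most half
   its measure and comparable to it: cut the cube into 2^d cubes if its side
   stays above the lower bound, and otherwise halve the interval in the
   coordinate [ln a]; the hypothesis on [beta] keeps the upper bound. The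
   John-Nirenberg stopping argument runs along these splittings down to a finite
   depth [n], for deviations truncated at [N]. Its error term is a multiple of
   the total mean oscillation over the pieces of depth [n], which tends to 0 for
   every integrable function. If M bounds the mean of the truncated p-th power
   deviation over all admissible sets, the argument improves M to a + M / 2,
   where [a] does not depend on [N]; iterate, then let [N] tend to infinity. *)

From HB Require Import structures.
Require Import Defs.
From mathcomp Require Import all_boot all_order all_algebra.
From mathcomp Require Import all_classical all_reals all_analysis.
From mathcomp Require Import measurable_realfun ring lra complex.

Set Implicit Arguments.
Unset Strict Implicit.
Unset Printing Implicit Defensive.

Import Order.TTheory GRing.Theory Num.Theory.
Import numFieldNormedType.Exports.

Local Open Scope classical_set_scope.
Local Open Scope ring_scope.

(** Depth-[n] oscillation stands in for Lebesgue differentiation. Functions whose oscillation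
    vanishes are closed under Lipschitz combinations and L^1 limits and include the coordinates,
    hence indicators of measurable sets, simple functions and all integrable functions. The
    coordinates qualify because, inside a fixed admissible set, the side condition keeps the side of
    the cube and the length of the interval in [ln a] comparable: a piece of small measure is small
    in every direction. Truncation provides a finite [M] to begin with, without which absorbing M /
    2 would say nothing; it also lets an L^1 error bound a p-th power. The stopping level is 2 * 2^p
    times the BMO_1 bound: the 2^p cancels the loss in the triangle inequality for p-th powers and
    the 2 leaves the factor 1 / 2. A dyadic cube lies in one orthant, so a compact set need not lie
    in a single admissible set; up to a null set it lies in 2^d of them, which gives local
    p-integrability. *)

(** * Lipschitz bounds, for unions of sets and for ramps approximating an indicator *)

Lemma max_lip (R : realDomainType) (a b c e : R) :
  `|Num.max a b - Num.max c e| <= `|a - c| + `|b - e|.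
Proof.
rewrite ler_norml.
have := ler_norm (a - c); have := lerNnormlW (lexx `|a - c|).
have := ler_norm (b - e); have := lerNnormlW (lexx `|b - e|).
have := normr_ge0 (a - c); have := normr_ge0 (b - e).
move=> h1 h2 h3 h4 h5 h6; apply/andP.
by split; case: (leP a b) => h7; case: (leP c e) => h8; lra.
Qed.

Lemma clip_lip (R : realDomainType) (a b : R) :
  `|Num.min 1 (Num.max 0 a) - Num.min 1 (Num.max 0 b)| <= `|a - b|.
Proof.
rewrite ler_norml.
have := ler_norm (a - b); have := lerNnormlW (lexx `|a - b|).
move=> h1 h2; apply/andP.
split; case: (leP 0 a) => h3; case: (leP 0 b) => h4;
  (try case: (leP 1 a) => h5); (try case: (leP 1 b) => h6);
  try case: (leP 1 (0 : R)) => h7; lra.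
Qed.

(** * Powers truncated at a level [N] *)

Section truncated_power.
Context {R : realType} (p : R).
Hypothesis p1 : 1 <= p.

Let p0 : 0 <= p. Proof. exact: le_trans p1. Qed.

Definition tpow (N y : R) : R := (Num.min `|y| N) `^ p.

Lemma measurable_tpow N : measurable_fun setT (tpow N).
Proof.
apply: (measurableT_comp (measurable_powR p)).
by apply: measurable_minr => //; exact: measurable_normr.
Qed.

Lemma tpow_le N y : 0 <= N -> tpow N y <= `|y| `^ p.
Proof.
move=> N0; apply: ge0_ler_powR => //; rewrite ?nnegrE// ?le_min ?normr_ge0//.
by rewrite ge_min lexx.
Qed.

Lemma tpow_leN N y : 0 <= N -> tpow N y <= N `^ p.
Proof.
move=> N0; apply: ge0_ler_powR => //; rewrite ?nnegrE// ?le_min ?normr_ge0//.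
by rewrite ge_min lexx orbT.
Qed.

(** This lets an L^1 quantity, the oscillation at depth [n], bound a truncated p-th power, at a cost
    depending on [N] only. *)
Lemma tpow_le_lin N y : 0 < N -> tpow N y <= N `^ (p - 1) * `|y|.
Proof.
move=> N0; have m0 : 0 <= Num.min `|y| N by rewrite le_min normr_ge0 ltW.
rewrite /tpow -mulr_powRB1// ?(lt_le_trans ltr01)// mulrC.
apply: ler_pM => //; rewrite ?powR_ge0// ?ge_min ?lexx//.
apply: ge0_ler_powR; rewrite ?subr_ge0 ?nnegrE ?(ltW N0)//.
by rewrite ge_min lexx orbT.
Qed.

(** The sum is at most twice the larger term, whence the constant 2^p. *)
Lemma powRD_le (a b : R) : 0 <= a -> 0 <= b ->
  (a + b) `^ p <= 2 `^ p * (a `^ p + b `^ p).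
Proof.
move=> a0 b0; wlog ab : a b a0 b0 / a <= b.
  move=> H; have [/H->//|/ltW ba] := leP a b.
  by rewrite addrC [X in _ * X]addrC; exact: H.
apply: (@le_trans _ _ ((2 * b) `^ p)).
  apply: ge0_ler_powR; rewrite ?nnegrE// ?addr_ge0 ?mulr_ge0//.
  by rewrite -nat1r mulrDl mul1r lerD2r.
by rewrite powRM// ler_pM2l ?powR_gt0// lerDr powR_ge0.
Qed.

Lemma tpowD N y z : 0 < N -> tpow N (y + z) <= 2 `^ p * (tpow N y + tpow N z).
Proof.
move=> N0; have m0 (t : R) : 0 <= Num.min `|t| N by rewrite le_min normr_ge0 ltW.
apply: le_trans (powRD_le (m0 y) (m0 z)).
apply: ge0_ler_powR; rewrite ?nnegrE// ?addr_ge0//.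
have := ler_normD y z; have := normr_ge0 y; have := normr_ge0 z.
set u := `|y|; set v := `|z|; set w := `|y + z| => h1 h2 h3.
by case: (leP w N) => h4; case: (leP u N) => h5; case: (leP v N) => h6; lra.
Qed.

End truncated_power.

(** * Means and mean deviations *)

Section mean.
Context d (T : measurableType d) (R : realType)
  (mu : {measure set T -> \bar R}).
Implicit Types (A : set T) (u v : T -> R).

Local Notation integrableR A u := (mu.-integrable A (EFin \o u)).

Definition vol A : R := fine (mu A).

Definition mean A u : R := (vol A)^-1 * \int[mu]_(x in A) u x.

(** Not divided by the volume, so that it is additive over a partition. *)
Definition dev A u (c : R) : R := \int[mu]_(x in A) `|u x - c|.

Lemma integrableR_cst A c : measurable A -> (mu A < +oo)%E ->
  integrableR A (cst c).
Proof.
move=> mA A_fin; apply: measurable_bounded_integrable => //.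
exists `|c|; split; first exact: num_real.
by move=> M cM x _ /=; exact: ltW.
Qed.

Lemma integrableRD A u v : measurable A -> integrableR A u -> integrableR A v ->
  integrableR A (fun x => u x + v x).
Proof. by move=> mA iu iv; exact: (integrableD mA iu iv). Qed.

Lemma integrableRB A u v : measurable A -> integrableR A u -> integrableR A v ->
  integrableR A (fun x => u x - v x).
Proof. by move=> mA iu iv; exact: (integrableB mA iu iv). Qed.

Lemma integrableRZ A k u : measurable A -> integrableR A u ->
  integrableR A (fun x => k * u x).
Proof. by move=> mA iu; exact: (integrableZl mA k iu). Qed.

Lemma integrableR_dev A u c : measurable A -> (mu A < +oo)%E ->
  integrableR A u -> integrableR A (fun x => `|u x - c|).
Proof.
move=> mA A_fin iu; apply: (@integrable_norm _ _ _ _ _ (fun x => u x - c)).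
by apply: integrableRB => //; exact: integrableR_cst.
Qed.

Lemma le_integrableR A u v : measurable A -> measurable_fun A u ->
  (forall x, A x -> `|u x| <= v x) -> integrableR A v -> integrableR A u.
Proof.
move=> mA mu_ uv; apply: le_integrable => //; first exact/measurable_EFinP.
by move=> x Ax /=; rewrite lee_fin (le_trans (uv x Ax))// ler_norm.
Qed.

Lemma measurable_integrableR A u : integrableR A u -> measurable_fun A u.
Proof. by move=> /measurable_int /measurable_EFinP. Qed.

Lemma integrableR_bounded A u M : measurable A -> (mu A < +oo)%E ->
  measurable_fun A u -> (forall x, A x -> `|u x| <= M) -> integrableR A u.
Proof.
move=> mA A_fin mu_ uM.
by apply: (le_integrableR (v := cst M)) => //; exact: integrableR_cst.
Qed.

Lemma Rintegral_cst_vol A c : measurable A -> \int[mu]_(x in A) c = c * vol A.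
Proof. by move=> mA; rewrite -(Rintegral_cst mu mA c). Qed.

Lemma dev_ge0 A u c : 0 <= dev A u c.
Proof. by apply: Rintegral_ge0. Qed.

Section atom.
Variable A : set T.
Hypothesis mA : measurable A.
Hypothesis A_gt0 : (0 < mu A)%E.
Hypothesis A_fin : (mu A < +oo)%E.

Lemma vol_gt0 : 0 < vol A.
Proof. by rewrite fine_gt0// A_gt0. Qed.

Lemma volE : mu A = (vol A)%:E.
Proof. by rewrite fineK// ge0_fin_numE. Qed.

Lemma mean_vol u : mean A u * vol A = \int[mu]_(x in A) u x.
Proof. by rewrite /mean mulrAC mulVf ?mul1r// gt_eqF// vol_gt0. Qed.

Lemma mean_dev u c : integrableR A u -> `|mean A u - c| * vol A <= dev A u c.
Proof.
move=> iu; have ic := integrableR_cst c mA A_fin.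
rewrite -[X in _ * X]gtr0_norm ?vol_gt0// -normrM mulrBl mean_vol.
rewrite -(Rintegral_cst_vol c mA) -RintegralB//.
by apply: le_normr_Rintegral => //; exact: integrableRB.
Qed.

(** Up to a factor 2 the mean is the best constant, so any convenient [c] may replace it. *)
Lemma dev_mean u c : integrableR A u -> dev A u (mean A u) <= 2 * dev A u c.
Proof.
move=> iu; have id c' := integrableR_dev c' mA A_fin iu.
have : dev A u (mean A u) <= dev A u c + `|mean A u - c| * vol A.
  rewrite -(Rintegral_cst_vol _ mA) -RintegralD//; last first.
    exact: integrableR_cst.
  apply: le_Rintegral => //.
    apply: integrableRD => //; exact: integrableR_cst.
  move=> x _; have -> : u x - mean A u = (u x - c) - (mean A u - c) by ring.
  by rewrite (le_trans (ler_normB _ _)).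
by move: (mean_dev c iu) => h1 h2; lra.
Qed.

End atom.

(** * Oscillation along an abstract splitting *)

Section dyadic.
(** [Q] stands for the admissible sets and [F] for a chosen splitting of each. That the pieces are
    disjoint and exhaust the set up to measure zero is encoded by [Fint]. *)
Variables (Q : set (set T)) (J : set T -> finType) (F : forall A, J A -> set T).
Hypothesis mQ : forall A, Q A -> measurable A.
Hypothesis Q_gt0 : forall A, Q A -> (0 < mu A)%E.
Hypothesis Q_fin : forall A, Q A -> (mu A < +oo)%E.
Hypothesis FQ : forall A (j : J A), Q A -> Q (F j).
Hypothesis FS : forall A (j : J A), Q A -> F j `<=` A.
Hypothesis Fhalf : forall A (j : J A), Q A -> vol (F j) <= vol A / 2.
Hypothesis Fint : forall A u, Q A -> integrableR A u ->
  \int[mu]_(x in A) u x = \sum_(j : J A) \int[mu]_(x in F j) u x.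

Fixpoint osc n A u : R :=
  if n is n'.+1 then \sum_(j : J A) osc n' (F j) u else dev A u (mean A u).

Let integrableRF A (j : J A) u : Q A -> integrableR A u -> integrableR (F j) u.
Proof.
move=> QA iu; apply: integrableS iu; [exact: mQ|exact/mQ/FQ|exact: FS].
Qed.

Lemma sum_vol A : Q A -> \sum_(j : J A) vol (F j) = vol A.
Proof.
move=> QA; rewrite -[RHS]mul1r -(Rintegral_cst_vol _ (mQ QA)).
rewrite Fint//; last by apply: integrableR_cst; [exact: mQ|exact: Q_fin].
by apply: eq_bigr => j _; rewrite Rintegral_cst_vol ?mul1r//; exact/mQ/FQ.
Qed.

Lemma dev_sum A u c : Q A -> integrableR A u ->
  dev A u c = \sum_(j : J A) dev (F j) u c.
Proof.
move=> QA iu; rewrite /dev Fint//.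
by apply: integrableR_dev => //; [exact: mQ|exact: Q_fin].
Qed.

Lemma osc_ge0 n A u : 0 <= osc n A u.
Proof.
elim: n A => [|n IH] A /=; first exact: dev_ge0.
by apply: sumr_ge0 => j _; exact: IH.
Qed.

(** Deviations from a fixed [c] add up over the pieces, and passing to the local means costs a
    factor 2. The bound is thus uniform in the depth. *)
Lemma osc_le_dev n A u c : Q A -> integrableR A u ->
  osc n A u <= 2 * dev A u c.
Proof.
elim: n A => [|n IH] A QA iu /=.
  by apply: dev_mean => //; [exact: mQ|exact: Q_gt0|exact: Q_fin].
rewrite dev_sum// mulr_sumr; apply: ler_sum => j _.
by apply: IH; [exact: FQ|exact: integrableRF].
Qed.

(** On each final piece [w] is compared with the value of [h] at the two means. Two arguments serve
    sums and maxima; a unary map ignores the second. *)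
Lemma osc_lip n A (h : R -> R -> R) (L : R) u v w : 0 <= L ->
  (forall a b c e, `|h a b - h c e| <= L * (`|a - c| + `|b - e|)) ->
  (forall x, w x = h (u x) (v x)) ->
  Q A -> integrableR A u -> integrableR A v -> integrableR A w ->
  osc n A w <= 2 * L * (osc n A u + osc n A v).
Proof.
move=> L0 hL wE; elim: n A => [|n IH] A QA iu iv iw /=; last first.
  rewrite -big_split/= mulr_sumr; apply: ler_sum => j _.
  by apply: IH; [exact: FQ|exact: integrableRF..].
have [mA A_fin] := (mQ QA, Q_fin QA).
have iu' c := integrableR_dev c mA A_fin iu.
have iv' c := integrableR_dev c mA A_fin iv.
have iw' c := integrableR_dev c mA A_fin iw.
apply: (le_trans (dev_mean mA (Q_gt0 QA) A_fin (h (mean A u) (mean A v)) iw)).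
rewrite -mulrA ler_pM2l// /dev -RintegralD// -RintegralZl//; last first.
  exact: integrableRD.
apply: le_Rintegral => //.
  by apply: integrableRZ => //; exact: integrableRD.
by move=> x _; rewrite wE; exact: hL.
Qed.

Definition vanishing_osc A u :=
  forall e, 0 < e -> \forall n \near \oo, osc n A u <= e.

Lemma vanishing_osc_lip A (h : R -> R -> R) (L : R) u v w : 0 < L ->
  (forall a b c e, `|h a b - h c e| <= L * (`|a - c| + `|b - e|)) ->
  (forall x, w x = h (u x) (v x)) ->
  Q A -> integrableR A u -> integrableR A v -> integrableR A w ->
  vanishing_osc A u -> vanishing_osc A v -> vanishing_osc A w.
Proof.
move=> L0 hL wE QA iu iv iw ou ov e e0.
have e'0 : 0 < e / (4 * L) by rewrite divr_gt0// mulr_gt0.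
near=> n; have := osc_lip n (ltW L0) hL wE QA iu iv iw.
have hu : osc n A u <= e / (4 * L) by near: n; exact: ou.
have hv : osc n A v <= e / (4 * L) by near: n; exact: ov.
move/le_trans; apply.
rewrite (_ : e = 2 * L * (e / (4 * L) + e / (4 * L))); last first.
  by field; rewrite gt_eqF.
by rewrite ler_pM2l ?mulr_gt0// lerD.
Unshelve. all: by end_near. Qed.

Lemma vanishing_osc_cst A c : Q A -> vanishing_osc A (cst c).
Proof.
move=> QA e e0; near=> n.
have := osc_le_dev n c QA (integrableR_cst c (mQ QA) (Q_fin QA)).
rewrite /dev; under eq_Rintegral do rewrite subrr normr0.
rewrite Rintegral_cst_vol ?mul0r ?mulr0; last exact: mQ.
by move/le_trans; apply; exact: ltW.
Unshelve. all: by end_near. Qed.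

(** Write [u] as [v] plus [u - v]; the oscillation of the remainder is bounded by its L^1 norm
    uniformly in the depth. *)
Lemma vanishing_osc_lim A u : Q A -> integrableR A u ->
  (forall e, 0 < e -> exists v, [/\ integrableR A v, vanishing_osc A v &
    \int[mu]_(x in A) `|u x - v x| <= e]) ->
  vanishing_osc A u.
Proof.
move=> QA iu lim e e0.
have e8 : 0 < e / 8 by rewrite divr_gt0.
have [v [iv ov uv]] := lim _ e8; near=> n.
have iuv := integrableRB (mQ QA) iu iv.
have hv : osc n A v <= e / 8 by near: n; exact: ov.
have huv : osc n A (fun x => u x - v x) <= 2 * (e / 8).
  apply: (le_trans (osc_le_dev n 0 QA iuv)); rewrite ler_pM2l//.
  by rewrite /dev; under eq_Rintegral do rewrite subr0.
have := @osc_lip n A +%R 1 v (fun x => u x - v x) u ler01.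
move=> /(_ _ _ QA iv iuv iu) H.
have {H} : osc n A u <= 2 * 1 * (osc n A v + osc n A (fun x => u x - v x)).
  apply: H => [a b c f|x]; last by ring.
  by rewrite mul1r opprD addrACA ler_normD.
by move=> H; lra.
Unshelve. all: by end_near. Qed.

(** Uniform continuity with smallness measured by volume, the size that the abstract splitting is
    known to reduce. *)
Definition shrinking A u := forall e, 0 < e -> exists2 eta, 0 < eta &
  forall B, Q B -> B `<=` A -> vol B <= eta ->
  forall x y, B x -> B y -> `|u x - u y| <= e.

Lemma vanishing_osc_shrinking A u : Q A -> integrableR A u ->
  shrinking A u -> vanishing_osc A u.
Proof.
move=> QA iu su e e0.
have volA := vol_gt0 (Q_gt0 QA) (Q_fin QA).
have e'0 : 0 < e / (2 * vol A) by rewrite divr_gt0// mulr_gt0.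
have [eta eta0 small] := su _ e'0.
(* Each split halves the volume, so a set of volume at most 2^n eta has all its pieces of depth [n]
   below [eta]. *)
have key n B : Q B -> B `<=` A -> vol B <= 2 ^+ n * eta ->
    osc n B u <= 2 * (e / (2 * vol A)) * vol B.
  elim: n B => [|n IH] B QB BA Bn /=; last first.
    rewrite -(sum_vol QB) mulr_sumr; apply: ler_sum => j _; apply: IH.
    - exact: FQ.
    - exact: subset_trans (FS QB) BA.
    - by move: (Fhalf j QB) Bn; rewrite exprS -mulrA; lra.
  have [x0 Bx0] : B !=set0.
    by apply/set0P/negP => /eqP B0; have := Q_gt0 QB; rewrite B0 measure0 ltxx.
  have [mB B_fin] := (mQ QB, Q_fin QB).
  have iuB : integrableR B u by apply: integrableS iu => //; exact: mQ.
  rewrite -mulrA -(Rintegral_cst_vol _ mB).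
  apply: (le_trans (dev_mean mB (Q_gt0 QB) B_fin (u x0) iuB)).
  rewrite ler_pM2l//; apply: le_Rintegral => //.
  - exact: integrableR_dev.
  - exact: integrableR_cst.
  - move=> x Bx; apply: (small B) => //.
    by move: Bn; rewrite expr0 mul1r.
near=> n; have -> : e = 2 * (e / (2 * vol A)) * vol A.
  by field; rewrite gt_eqF.
apply: key => //; rewrite -ler_pdivrMr//.
apply: (@le_trans _ _ n%:R); first by near: n; exact: nbhs_infty_ger.
by rewrite -natrX ler_nat ltnW// ltn_expl.
Unshelve. all: by end_near. Qed.

(** * From generating functions to all integrable functions *)

Section generated.
Variables (K : Type) (phi : K -> T -> R).
Hypothesis measurable_phi : forall i, measurable_fun setT (phi i).
Hypothesis shrinking_phi : forall A i, Q A -> shrinking A (phi i).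
Hypothesis phi_generates : forall G : set (set T), sigma_algebra setT G ->
  (forall i c, G [set x | phi i x < c]) -> measurable `<=` G.

Let integrableR_indic A B : Q A -> measurable B ->
  integrableR A (\1_B : T -> R).
Proof.
move=> QA mB; apply: (@integrableR_bounded _ _ 1).
- exact: mQ.
- exact: Q_fin.
- exact: measurable_indic.
- by move=> x _; rewrite indicE; case: (_ \in _); rewrite ?normr1 ?normr0.
Qed.

(** The L^1 error is at most the measure of [E k] inside [A], which tends to 0 by continuity from
    above. *)
Lemma vanishing_osc_indic_lim A B (v : nat -> T -> R) (E : nat -> set T) :
  Q A -> measurable B ->
  (forall k, integrableR A (v k)) -> (forall k, vanishing_osc A (v k)) ->
  (forall k, measurable (E k)) -> nonincreasing_seq E -> \bigcap_k E k = set0 ->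
  (forall k x, `|\1_B x - v k x| <= \1_(E k) x) ->
  vanishing_osc A (\1_B : T -> R).
Proof.
move=> QA mB iv ov mE niE E0 vE.
have [mA A_fin] := (mQ QA, Q_fin QA).
have iB := integrableR_indic QA mB.
apply: vanishing_osc_lim => // e e0.
have : mu \o (fun k => E k `&` A) @ \oo --> mu (\bigcap_k (E k `&` A)).
  apply: nonincreasing_cvg_mu.
  - by apply: (le_lt_trans _ A_fin); apply: le_measure;
      rewrite ?inE//; exact: measurableI.
  - by move=> k; exact: measurableI.
  - by apply: bigcapT_measurable => k; exact: measurableI.
  - by move=> i j ij; apply/subsetPset; apply: setSI; apply/subsetPset/niE.
have -> : \bigcap_k (E k `&` A) = set0.
  by apply/seteqP; split => // x Ex; rewrite -E0 => k _; have [] := Ex k I.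
rewrite measure0 => /fine_cvgP[fin_E /cvgrPdist_le/(_ _ e0)] [k _ small].
exists (v k); split => //.
have /= := small k (leqnn _); rewrite sub0r normrN ger0_norm ?fine_ge0//.
apply: le_trans.
have -> : fine (mu (E k `&` A)) = \int[mu]_(x in A) \1_(E k) x.
  by rewrite /Rintegral integral_indic.
apply: le_Rintegral => //.
- apply: (@integrable_norm _ _ _ _ _ (fun x => \1_B x - v k x)).
  exact: integrableRB.
- exact: integrableR_indic.
Qed.

(** The sets with this property form a sigma-algebra: complements by 1 - a, finite unions by max,
    countable unions by limits. It contains the sublevel sets of every [phi i]. *)
Lemma vanishing_osc_indic A B : Q A -> measurable B ->
  vanishing_osc A (\1_B : T -> R).
Proof.
move=> QA; move: B.
have [mA A_fin] := (mQ QA, Q_fin QA).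
pose G := [set B | measurable B /\ vanishing_osc A (\1_B : T -> R)].
have GU B C : G B -> G C -> G (B `|` C).
  move=> [mB oB] [mC oC]; have mBC := measurableU _ _ mB mC; split => //.
  apply: (@vanishing_osc_lip A Num.max 1 (\1_B) (\1_C)) => //;
    do ?exact: integrableR_indic.
  - by move=> a b c e; rewrite mul1r; exact: max_lip.
  - move=> x; rewrite !indicE in_setU.
    by case: (x \in B); case: (x \in C); rewrite /= ?maxxx// ?(max_l ler01) ?(max_r ler01).
suff H : measurable `<=` G by move=> B /H[].
apply: phi_generates => [|i c]; last first.
  (* A ramp in [phi i x] of slope [k], clipped to [0, 1] and vanishing above [c]. [v k.+1] differs
     from the indicator only on the strip [E k], of width 1 / (k + 1). *)
  pose v k x := Num.min 1 (Num.max 0 (k%:R * (c - phi i x))).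
  pose E k := [set x | phi i x \in `](c - k.+1%:R^-1), c[].
  have mpre (Y : interval R) : measurable [set x | phi i x \in Y].
    rewrite -[X in measurable X]setTI.
    exact: (measurable_phi i measurableT (measurable_itv Y)).
  have mphi : measurable [set x | phi i x < c].
    by rewrite (_ : [set _ | _] = [set x | phi i x \in `]-oo, c[]).
  have mv k : measurable_fun setT (v k).
    apply: measurable_minr => //; apply: measurable_maxr => //.
    by apply: measurable_funM => //; exact: measurable_funB.
  have v01 k x : 0 <= v k x <= 1.
    by rewrite /v le_min ler01/= le_max lexx/= ge_min lexx.
  have iv k : integrableR A (v k).
    apply: (@integrableR_bounded _ _ 1) => //; first exact: measurable_funTS.
    by move=> x _; have /andP[v0 v1] := v01 k x; rewrite ger0_norm.
  split => //.
  apply: (@vanishing_osc_indic_lim A _ (fun k => v k.+1) E) => //.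
  - move=> k; apply: vanishing_osc_shrinking => // e e0.
    have [eta eta0 small] := shrinking_phi i QA (divr_gt0 e0 (ltr0Sn R k)).
    exists eta => // B QB BA Beta x y Bx By.
    have := small B QB BA Beta y x By Bx; rewrite ler_pdivlMr// => /(le_trans _).
    apply; apply: le_trans (clip_lip _ _) _.
    by rewrite -mulrBr normrM ger0_norm// mulrC opprB addrC addrA subrK.
  - by move=> k; exact: mpre.
  - move=> j k jk; apply/subsetPset => x; rewrite /E/= !in_itv/= => /andP[xc ->].
    rewrite andbT (le_lt_trans _ xc)// lerD2l lerN2 lef_pV2 ?posrE//.
    by rewrite ler_nat ltnS.
  - apply/seteqP; split => // x /= Ex.
    have : phi i x < c by have := Ex 0%N Logic.I; rewrite /E/= in_itv => /andP[].
    move=> /ltr_add_invr[k]; have := Ex k Logic.I.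
    rewrite /E/= in_itv/= ltrBlDr => /andP[h _] h'.
    by have := lt_trans h h'; rewrite ltxx.
  - move=> k x; rewrite !indicE.
    have [xE|xE] := boolP (x \in E k).
      have /andP[v0 v1] := v01 k.+1 x.
      case: (_ \in _) => /=; last by rewrite sub0r normrN ger0_norm.
      by rewrite ger0_norm ?subr_ge0// lerBlDr lerDl.
    have [xB|xB] := boolP (x \in _).
      have {}xB : phi i x < c by rewrite inE in xB.
      move: xE; rewrite notin_setE /E/= in_itv/= xB andbT => /negP.
      rewrite -leNgt => xE; rewrite /v min_l ?subrr ?normr0// le_max.
      by apply/orP; right; rewrite mulrC -ler_pdivrMr// div1r lerBrDr -lerBrDl.
    have {}xB : c <= phi i x by move: xB; rewrite notin_setE/= => /negP; rewrite -leNgt.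
    rewrite /v max_l; first by rewrite min_r// subrr normr0.
    by rewrite mulr_ge0_le0// subr_le0.
split.
- split => //; rewrite indic0; exact: vanishing_osc_cst.
- move=> B [mB oB]; rewrite setTD.
  have mBC := measurableC mB; split => //.
  apply: (@vanishing_osc_lip A (fun a _ => 1 - a) 1 (\1_B) (\1_B)) => //;
    do ?exact: integrableR_indic.
  + move=> a b c e /=; rewrite mul1r (_ : 1 - a - (1 - c) = c - a); last by ring.
    by rewrite distrC lerDl.
  + by move=> x; rewrite !indicE in_setC; case: (_ \in _); rewrite ?subr0 ?subrr.
- move=> B GB; have mB k := (GB k).1; split.
    exact: bigcupT_measurable.
  have GV k : G (\big[setU/set0]_(i < k) B i).
    elim: k => [|k IH]; last by rewrite big_ord_recr; exact: GU.
    by rewrite big_ord0; split => //; rewrite indic0; exact: vanishing_osc_cst.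
  have mV k := (GV k).1.
  (* What the first [k] sets leave out of the union decreases to the empty set. *)
  apply: (@vanishing_osc_indic_lim A _ (fun k => \1_(\big[setU/set0]_(i < k) B i))
    (fun k => \bigcup_i B i `\` \big[setU/set0]_(i < k) B i)) => //.
  + exact: bigcupT_measurable.
  + by move=> k; exact: integrableR_indic.
  + by move=> k; have [] := GV k.
  + by move=> k; apply: measurableD => //; exact: bigcupT_measurable.
  + move=> i j ij; apply/subsetPset; apply: setDS.
    exact: subset_bigsetU.
  + apply/seteqP; split => // x Ex.
    have [[i _ Bix] _] := Ex 0%N I; have [_] := Ex i.+1 I; apply.
    by rewrite big_ord_recr; right.
  + move=> k x; rewrite !indicE.
    have [Vx|Vx] := boolP (x \in \big[setU/set0]_(i < k) B i).
      have -> : x \in \bigcup_i B i.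
        move: Vx; rewrite !inE -bigcup_mkord => -[i _ Bix]; by exists i.
      by rewrite subrr normr0.
    rewrite subr0 ger0_norm//; have [Bx|Bx] := boolP (x \in \bigcup_i B i) => //.
    suff -> : x \in \bigcup_i B i `\` \big[setU/set0]_(i < k) B i by [].
    by move: Bx Vx; rewrite !inE notin_setE => Bx Vx.
Qed.

Import HBSimple.

Lemma vanishing_osc_sfun A (g : {sfun T >-> R}) :
  Q A -> vanishing_osc A (fun x => g x).
Proof.
move=> QA; have [mA A_fin] := (mQ QA, Q_fin QA).
(* An arbitrary list of values with [g] fixed makes induction on the list possible. *)
suff H (s : seq R) :
    let f x := \sum_(y <- s) (y * \1_(g @^-1` [set y]) x) in
    integrableR A f /\ vanishing_osc A f.
  under eq_fun do rewrite fimfunE fsbig_finite//=.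
  exact: (H _).2.
elim: s => [|y s [is_ os]] f; rewrite {}/f.
  under eq_fun do rewrite big_nil; split; first exact: integrableR_cst.
  exact: vanishing_osc_cst.
under eq_fun do rewrite big_cons.
have mg : measurable (g @^-1` [set y]) by [].
have ig := integrableR_indic QA mg; have iyg := integrableRZ y mA ig.
have isum := integrableRD mA iyg is_; split => //.
apply: (@vanishing_osc_lip A +%R 1 _ _ _ ltr01 _ _ QA iyg is_ isum _ os) => //.
  by move=> a b c e; rewrite mul1r opprD addrACA ler_normD.
(* The [+ 1] keeps the Lipschitz constant positive when [y] is 0. *)
have y0 : 0 < `|y| + 1 by rewrite ltr_pwDr.
apply: (@vanishing_osc_lip A (fun a _ => y * a) _ _ _ _ y0 _ _ QA ig ig iyg);
  rewrite //=; try exact: vanishing_osc_indic.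
by move=> a b c e; rewrite -mulrBr normrM ler_pM// ?lerDl.
Qed.

(** Simple functions are dense in L^1, and the property passes to L^1 limits. *)
Lemma vanishing_osc_integrable A u : Q A -> integrableR A u ->
  vanishing_osc A u.
Proof.
move=> QA iu; apply: vanishing_osc_lim => // e e0.
have [g [ig _]] := approximation_sfun_integrable (mQ QA) iu.
move=> /fine_cvgP[_ /cvgrPdist_le/(_ _ e0)] [k _ small].
exists (g k); split; first exact: ig.
  exact: vanishing_osc_sfun.
have /= := small k (leqnn _); rewrite sub0r normrN ger0_norm//.
by rewrite fine_ge0// integral_ge0.
Qed.

(** * The stopping argument and the absorption of [M] *)

Section john_nirenberg.
Variable D : R.
Hypothesis FD : forall A (j : J A), Q A -> vol A <= D * vol (F j).
Variable p : R.
Hypothesis p1 : 1 <= p.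
Variable f : T -> R.
Hypothesis f_int : forall A, Q A -> integrableR A f.

Let tp N y := tpow p N y.

Let integrableR_tp N A c : 0 <= N -> Q A -> integrableR A (fun x => tp N (f x - c)).
Proof.
move=> N0 QA; have [mA A_fin] := (mQ QA, Q_fin QA).
apply: (@integrableR_bounded _ _ (N `^ p)) => //.
  apply: (measurableT_comp (measurable_tpow p N)).
  by apply: measurable_funB => //; exact/measurable_integrableR/f_int.
move=> x _; rewrite ger0_norm ?powR_ge0//; exact: tpow_leN.
Qed.

(* [A] is split down to depth [n], stopping at the first descendant on which
   the mean of [|f - c|] exceeds [lam]. *)
Lemma tpow_stopping N M lam n A c : 0 < N -> 0 <= M -> 0 < lam ->
  (forall B, Q B -> \int[mu]_(x in B) tp N (f x - mean B f) <= M * vol B) ->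
  Q A -> dev A f c <= lam * vol A ->
  \int[mu]_(x in A) tp N (f x - c) <=
  2 `^ p * lam `^ p * vol A + 2 `^ p * N `^ (p - 1) * osc n A (fun x => `|f x - c|)
  + 2 `^ p * (M + (D * lam) `^ p) / lam * dev A f c.
Proof.
move=> N0 M0 lam0 hM; elim: n A => [|n IH] A QA devA;
  have [mA A_fin] := (mQ QA, Q_fin QA); have iA := f_int QA;
  have iu := integrableR_dev c mA A_fin iA.
(* Depth exhausted without stopping: the mean [a] of [|f - c|] is at most [lam], and the deviation
   from [a] is charged to the oscillation term. *)
- set u := fun x => `|f x - c|; set a := mean A u.
  have volA := vol_gt0 (Q_gt0 QA) A_fin.
  have a0 : 0 <= a.
    rewrite mulr_ge0 ?invr_ge0 ?(ltW volA)//.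
    by apply: Rintegral_ge0 => x _; exact: normr_ge0.
  have alam : a <= lam by rewrite /a /mean mulrC ler_pdivrMr.
  have C0 : 0 <= 2 `^ p * (M + (D * lam) `^ p) / lam * dev A f c.
    by rewrite mulr_ge0 ?dev_ge0// divr_ge0 ?(ltW lam0)// mulr_ge0 ?powR_ge0//
      addr_ge0 ?powR_ge0.
  have iua := integrableR_dev a mA A_fin iu.
  rewrite -[X in X <= _]addr0; apply: lerD => //.
  rewrite /osc -/u -/a /dev -(Rintegral_cst_vol _ mA).
  rewrite -RintegralZl// -RintegralD//; last 2 first.
  + exact: integrableR_cst.
  + exact: integrableRZ.
  apply: le_Rintegral => //.
  + by apply: integrableR_tp => //; exact: ltW.
  + by apply: integrableRD => //; [exact: integrableR_cst|exact: integrableRZ].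
  move=> x _; rewrite (_ : tp N (f x - c) = tp N (a + (u x - a))); last first.
    by rewrite (addrC a) subrK /tp /tpow normr_id.
  apply: (le_trans (tpowD p1 _ _ N0)); rewrite -mulrA -mulrDr.
  rewrite ler_pM2l ?powR_gt0//; apply: lerD; last exact: tpow_le_lin.
  apply: (le_trans (tpow_le p1 _ (ltW N0))); rewrite ger0_norm//.
  by apply: ge0_ler_powR; rewrite ?nnegrE// ?(le_trans ler01 p1)// ltW.
have C0 : 0 <= 2 `^ p * (M + (D * lam) `^ p) / lam.
  by rewrite divr_ge0 ?(ltW lam0)// mulr_ge0 ?powR_ge0// addr_ge0 ?powR_ge0.
rewrite Fint//; last by apply: integrableR_tp => //; exact: ltW.
rewrite -(sum_vol QA) (dev_sum c QA iA) /= !mulr_sumr -!big_split/=.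
apply: ler_sum => j _.
have QB := FQ j QA; set B := F j.
have [mB B_fin] := (mQ QB, Q_fin QB); have iB := f_int QB.
(* A good piece is split further; at a bad one the splitting stops and the hypothesis on [M] takes
   over. *)
have [good|bad] := leP (dev B f c) (lam * vol B); first exact: IH.
have volB := vol_gt0 (Q_gt0 QB) B_fin.
apply: (@le_trans _ _ (2 `^ p * (M + (D * lam) `^ p) * vol B)).
  (* The parent [A] was not stopped and [B] has at least 1 / D of its volume, so the mean moves by
     at most [D * lam]. *)
  have mean_c : `|mean B f - c| <= D * lam.
    rewrite -(ler_pM2r volB); apply: (le_trans (mean_dev mB (Q_gt0 QB) B_fin c iB)).
    apply: (@le_trans _ _ (dev A f c)).
      rewrite (dev_sum c QA iA) (bigD1 j)//= lerDl.
      by apply: sumr_ge0 => i _; exact: dev_ge0.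
    by rewrite (le_trans devA)// mulrAC mulrC ler_pM2r// FD.
  apply: (@le_trans _ _ (\int[mu]_(x in B)
      (2 `^ p * (tp N (f x - mean B f) + (D * lam) `^ p)))).
    apply: le_Rintegral => //.
    - by apply: integrableR_tp => //; exact: ltW.
    - apply: integrableRZ => //; apply: integrableRD => //.
        by apply: integrableR_tp => //; exact: ltW.
      exact: integrableR_cst.
    move=> x _; rewrite (_ : f x - c = (f x - mean B f) + (mean B f - c)); last first.
      by rewrite addrA subrK.
    apply: (le_trans (tpowD p1 _ _ N0)); rewrite ler_pM2l ?powR_gt0// lerD2l.
    apply: (le_trans (tpow_le p1 _ (ltW N0))).
    apply: ge0_ler_powR; rewrite ?nnegrE// ?(le_trans ler01 p1)//.
    exact: le_trans mean_c.
  rewrite RintegralZl//; last first.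
    apply: integrableRD => //; last exact: integrableR_cst.
    by apply: integrableR_tp => //; exact: ltW.
  rewrite RintegralD//; last 2 first.
  - by apply: integrableR_tp => //; exact: ltW.
  - exact: integrableR_cst.
  rewrite Rintegral_cst_vol// -mulrA ler_pM2l ?powR_gt0// mulrDl lerD2r.
  exact: hM.
(* Being stopped means that the volume of [B] is below its deviation divided by [lam]; deviations of
   disjoint pieces add up. *)
apply: (@le_trans _ _ (2 `^ p * (M + (D * lam) `^ p) / lam * dev B f c)).
  rewrite -[leRHS]mulrA ler_wpM2l//.
    by rewrite mulr_ge0 ?powR_ge0// addr_ge0 ?powR_ge0.
  by rewrite mulrC ler_pdivlMr// mulrC ltW.
rewrite lerDr addr_ge0// !mulr_ge0 ?powR_ge0 ?osc_ge0//; exact: ltW.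
Qed.

Hypothesis D0 : 0 <= D.
Variable b : R.
Hypothesis b0 : 0 < b.
Hypothesis f_bmo : forall A, Q A -> dev A f (mean A f) <= b * vol A.

(** Makes 2^p b / lam equal to 1 / 2, the factor of [M] after one round. *)
Let lam := 2 * 2 `^ p * b.

Let lam0 : 0 < lam. Proof. by rewrite !mulr_gt0// powR_gt0. Qed.

Let tpow_bmo_step N M A : 0 < N -> 0 <= M ->
  (forall B, Q B -> \int[mu]_(x in B) tp N (f x - mean B f) <= M * vol B) ->
  Q A -> \int[mu]_(x in A) tp N (f x - mean A f) <=
    (2 `^ p * lam `^ p + (M + (D * lam) `^ p) / 2) * vol A.
Proof.
move=> N0 M0 hM QA; have [mA A_fin] := (mQ QA, Q_fin QA).
have volA := vol_gt0 (Q_gt0 QA) A_fin.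
apply/ler_addgt0Pr => e e0.
have K0 : 0 < 2 `^ p * N `^ (p - 1) by rewrite mulr_gt0// powR_gt0.
have iu := integrableR_dev (mean A f) mA A_fin (f_int QA).
(* The depth depends on [N], [A] and [e], but leaves no trace in the bound. *)
have [n _ osc_small] := vanishing_osc_integrable QA iu (divr_gt0 e0 K0).
have := osc_small n (leqnn n); rewrite /= ler_pdivlMr// mulrC => {osc_small}osc_e.
have dev_lam : dev A f (mean A f) <= lam * vol A.
  apply: (le_trans (f_bmo QA)); rewrite ler_pM2r// ler_peMl ?(ltW b0)//.
  rewrite mulr_ege1 ?ler1n// -[leLHS](powRr0 2).
  by rewrite ler_powR ?ler1n// (le_trans ler01).
apply: (le_trans (tpow_stopping n N0 M0 lam0 hM QA dev_lam)).
have -> : (2 `^ p * lam `^ p + (M + (D * lam) `^ p) / 2) * vol A + e =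
  2 `^ p * lam `^ p * vol A + e + (M + (D * lam) `^ p) / 2 * vol A by ring.
rewrite lerD ?lerD2l//.
apply: (@le_trans _ _ (2 `^ p * (M + (D * lam) `^ p) / lam * (b * vol A))).
  rewrite ler_wpM2l ?f_bmo// divr_ge0 ?(ltW lam0)// mulr_ge0 ?powR_ge0//.
  by rewrite addr_ge0 ?powR_ge0.
rewrite le_eqVlt; apply/orP; left; apply/eqP; rewrite {2}/lam; field.
by rewrite !gt_eqF ?powR_gt0.
Qed.

(** The constant is the fixed point of M |-> 2^p lam^p + (M + (D lam)^p) / 2. The initial excess
    over it, N^p, is halved in each round. *)
Lemma tpow_bmo N A : 0 < N -> Q A ->
  \int[mu]_(x in A) tp N (f x - mean A f) <=
    (2 * 2 `^ p * lam `^ p + (D * lam) `^ p) * vol A.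
Proof.
set a := _ + _; move=> N0.
have a0 : 0 <= a by rewrite addr_ge0 ?mulr_ge0 ?powR_ge0.
have iter k : forall B, Q B ->
    \int[mu]_(x in B) tp N (f x - mean B f) <= (a + N `^ p / 2 ^+ k) * vol B.
  elim: k => [|k IH] B QB.
    have [mB B_fin] := (mQ QB, Q_fin QB); rewrite expr0 divr1.
    rewrite -(Rintegral_cst_vol _ mB); apply: le_Rintegral => //.
    - by apply: integrableR_tp => //; exact: ltW.
    - exact: integrableR_cst.
    - by move=> x _; rewrite (le_trans (tpow_leN p1 _ (ltW N0)))// lerDr.
  have M0 : 0 <= a + N `^ p / 2 ^+ k.
    by rewrite addr_ge0// divr_ge0 ?powR_ge0// exprn_ge0.
  apply: (le_trans (tpow_bmo_step N0 M0 IH QB)).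
  rewrite le_eqVlt; apply/orP; left; apply/eqP; rewrite exprS /a; field.
  by rewrite expf_neq0.
move=> QA; have volA := vol_gt0 (Q_gt0 QA) (Q_fin QA).
apply/ler_addgt0Pr => e e0.
have Np : 0 < N `^ p * vol A / e by rewrite divr_gt0// mulr_gt0// powR_gt0.
have [k _ hk] := nbhs_infty_ger (N `^ p * vol A / e).
apply: (le_trans (iter k A QA)); rewrite mulrDl lerD2l mulrAC.
rewrite ler_pdivrMr ?exprn_gt0// [leRHS]mulrC -ler_pdivrMr//.
apply: (le_trans (hk k (leqnn k))); rewrite -natrX ler_nat.
exact/ltnW/ltn_expl.
Qed.

(** Monotone convergence removes the truncation. Since [lam] is a fixed multiple of [b], the bound
    is homogeneous of degree [p] in [b]. *)
Lemma john_nirenberg A : Q A ->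
  (\int[mu]_(x in A) (`|f x - mean A f| `^ p)%:E <=
    ((2 * 2 `^ p * (2 * 2 `^ p) `^ p + (D * (2 * 2 `^ p)) `^ p)
      * b `^ p * vol A)%:E)%E.
Proof.
move=> QA; have [mA A_fin] := (mQ QA, Q_fin QA).
have mf : measurable_fun A (fun x => f x - mean A f).
  by apply: measurable_funB => //; exact/measurable_integrableR/f_int.
(* The truncations are eventually constant; the levels begin at 1 so as to be positive. *)
have tpE x : (`|f x - mean A f| `^ p)%:E =
    limn (fun k => (tp k.+1%:R (f x - mean A f))%:E).
  apply/esym/cvg_lim => //; apply: cvg_near_cst.
  near=> k; rewrite /tp /tpow min_l//.
  apply: (@le_trans _ _ k%:R); last by rewrite ler_nat.
  by near: k; exact: nbhs_infty_ger.
under eq_integral do rewrite tpE.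
rewrite monotone_convergence//; last 3 first.
- move=> k; apply/measurable_EFinP.
  exact: (measurableT_comp (measurable_tpow p _)).
- by move=> k x _; rewrite lee_fin powR_ge0.
- move=> x _ j k jk; rewrite lee_fin; apply: ge0_ler_powR.
  + exact: le_trans p1.
  + by rewrite nnegrE le_min normr_ge0/=.
  + by rewrite nnegrE le_min normr_ge0/=.
  + by rewrite le_min ge_min lexx/= ge_min ler_nat ltnS jk orbT.
apply: lime_le.
  apply: ereal_nondecreasing_is_cvgn => j k jk.
  apply: ge0_le_integral => //.
  - by move=> x _; rewrite lee_fin powR_ge0.
  - by apply/measurable_EFinP; exact: (measurableT_comp (measurable_tpow p _)).
  - by apply/measurable_EFinP; exact: (measurableT_comp (measurable_tpow p _)).
  - move=> x _; rewrite lee_fin; apply: ge0_ler_powR.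
    + exact: le_trans p1.
    + by rewrite nnegrE le_min normr_ge0/=.
    + by rewrite nnegrE le_min normr_ge0/=.
    + by rewrite le_min ge_min lexx/= ge_min ler_nat ltnS jk orbT.
apply: nearW => k.
have k0 : (0 : R) < k.+1%:R by [].
rewrite -[X in (X <= _)%E]fineK; last first.
  apply: integrable_fin_num => //; exact: (integrableR_tp _ (ltW k0)).
rewrite lee_fin; apply: (le_trans (tpow_bmo k0 QA)).
rewrite le_eqVlt; apply/orP; left; apply/eqP; rewrite /lam.
by rewrite mulrA !powRM ?mulr_ge0 ?powR_ge0 ?(ltW b0)//; ring.
Unshelve. all: by end_near. Qed.

End john_nirenberg.
End generated.
End dyadic.
End mean.

(** * Lebesgue measure of cubes *)

Section box.
Context {R : realType}.

Definition box n (c : 'I_n -> R) (h : R) : set 'rV[R]_n :=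
  [set x | forall i, `|x ord0 i - c i| < h].

Lemma measurable_box n (c : 'I_n -> R) h : measurable (box c h).
Proof.
have -> : box c h = \bigcap_(i in [set: 'I_n]) [set x | `|x ord0 i - c i| < h].
  by apply/seteqP; split => x /= hx i; [move=> _|]; exact: hx.
apply: fin_bigcap_measurable => // i _.
have mi : measurable_fun setT (fun x : 'rV[R]_n => `|x ord0 i - c i|).
  apply: measurableT_comp => //; apply: measurable_funB => //.
  exact: measurable_coord.
have := mi measurableT `]-oo, h[%classic (measurable_itv _); rewrite setTI.
by congr measurable; apply/seteqP; split => x /=; rewrite in_itv.
Qed.

Lemma lebesgue_R_itvoo (a b : R) : a <= b ->
  (lebesgue_R : {measure set R -> \bar R}) `]a, b[%classic = (b - a)%:E.
Proof.
rewrite le_eqVlt => /orP[/eqP ->|ab].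
  by rewrite set_itv_ge ?bnd_simp ?ltxx// subrr; exact: measure0.
have := lebesgue_measure_itv `]a, b[; rewrite /= lte_fin ab -EFinB; exact.
Qed.

Lemma lebesgue_box n (c : 'I_n -> R) h : 0 <= h ->
  lebesgue_rV n (box c h) = ((2 * h) ^+ n)%:E.
Proof.
move=> h0; elim: n c => [|n IH] c.
  (* In dimension 0 the space is one point of mass 1, and (2h)^0 = 1 even for h = 0. *)
  rewrite expr0 /= /dirac_rV0 diracE mem_set//.
  by move=> -[].
have -> : lebesgue_rV n.+1 (box c h) =
    (lebesgue_R \x lebesgue_rV n)%E (@rVcons R n @^-1` box c h) by [].
have -> : @rVcons R n @^-1` box c h =
    `](c ord0 - h), (c ord0 + h)[ `*` box (fun i => c (lift ord0 i)) h.
  apply/seteqP; split => -[a x] /=; rewrite /box /rVcons /= in_itv /=.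
    move=> hx; have := hx ord0; rewrite mxE unlift_none -ltr_distlC distrC.
    by split => // i; have := hx (lift ord0 i); rewrite mxE liftK.
  rewrite -ltr_distlC distrC => -[ha hx] i; rewrite mxE.
  by case: (unliftP ord0 i) => [j ->|->].
rewrite product_measure1E//; last exact: measurable_box.
rewrite IH lebesgue_R_itvoo; last lra.
by rewrite -EFinM; congr EFin; rewrite exprS; ring.
Qed.

End box.

(** * Haar measure of the product of a cube and an interval *)

Section slab.
Context {R : realType} {d : nat}.
Implicit Types (c : 'I_d -> R) (h t s : R).

Local Notation haar := (right_haar : {measure set ('rV[R]_d * R) -> \bar R}).

(* The logarithmic coordinates [t = ln a0] and [s = ln r]. *)
Definition slab c h t s : set ('rV[R]_d * R) :=
  box c h `*` `]expR (t - s), expR (t + s)[.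

Lemma measurable_slab c h t s : measurable (slab c h t s).
Proof. by apply: measurableX => //; exact: measurable_box. Qed.

Lemma slab_axb c h t s : slab c h t s `<=` axb.
Proof.
move=> z [_ /=]; rewrite in_itv/= => /andP[h1 _].
by rewrite /axb/= (lt_trans _ h1)// expR_gt0.
Qed.

(** [ln] is a primitive of 1 / y: in the coordinate [ln a] the Haar density becomes constant. *)
Lemma integral_inv_expR (a b : R) : a <= b ->
  (\int[lebesgue_R]_(y in `]expR a, expR b[) (y^-1)%:E = (b - a)%:E)%E.
Proof.
rewrite le_eqVlt => /orP[/eqP ->|ab].
  by rewrite subrr set_itv_ge ?bnd_simp ?ltxx// integral_set0.
have eab : expR a < expR b by rewrite ltr_expR.
have pos x : x \in `[expR a, expR b] -> 0 < x.
  by rewrite in_itv/= => /andP[+ _]; apply: lt_le_trans; exact: expR_gt0.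
have cinv x : x \in `[expR a, expR b] -> {for x, continuous (@GRing.inv R)}.
  by move=> xab; apply: inv_continuous; rewrite gt_eqF// pos.
have cln x : x \in `[expR a, expR b] -> {for x, continuous (@ln R)}.
  by move=> xab; apply: continuous_ln; exact: pos.
have minv : measurable_fun `]expR a, expR b[ (@GRing.inv R).
  apply: open_continuous_measurable_fun => // x.
  rewrite inE/= => xab; apply: cinv; exact: subset_itv_oo_cc.
(* Passes to a closed interval, for the fundamental theorem of calculus, and from [lebesgue_R] to
   the same measure on the other copy of the reals. *)
transitivity (\int[@lebesgue_measure R]_(y in `[expR a, expR b]) (y^-1)%:E)%E.
  rewrite integral_itv_bndoo; last exact/measurable_EFinP.
  have mid : measurable_fun setT (id : measurableTypeR R -> R) by [].
  apply: (@ge0_integral_pushforward _ _ (measurableTypeR R) R _ id mid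
    lebesgue_measure `]expR a, expR b[%classic (fun y : R => (y^-1)%:E)) => //.
    exact/measurable_EFinP.
  by move=> y; rewrite inE /= => yab; rewrite lee_fin invr_ge0 ltW// pos// subset_itv_oo_cc.
rewrite (@continuous_FTC2 _ _ (@ln R))//.
- by rewrite !expRK.
- apply: continuous_in_subspaceT => x; rewrite inE/=; exact: cinv.
- split.
  + move=> x xab; have x0 : 0 < x by apply: pos; exact: subset_itv_oo_cc.
    by have [] := is_derive1_ln x0.
  + apply: cvg_at_right_filter; apply: cln; rewrite in_itv/= lexx; exact: ltW.
  + apply: cvg_at_left_filter; apply: cln; rewrite in_itv/= lexx andbT; exact: ltW.
- move=> x xab; have x0 : 0 < x by apply: pos; exact: subset_itv_oo_cc.
  by rewrite derive1E; have [_ ->] := is_derive1_ln x0.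
Qed.

Lemma haar_slab c h t s : 0 <= h -> 0 <= s ->
  haar (slab c h t s) = ((2 * h) ^+ d * (2 * s))%:E.
Proof.
move=> h0 s0.
rewrite -[LHS]/(\int[lebesgue_rV d \x lebesgue_R]_(z in slab c h t s `&` axb) (z.2^-1)%:E)%E.
have -> : slab c h t s `&` axb = slab c h t s.
  by apply/setIidl; exact: slab_axb.
have mS := measurable_slab c h t s.
rewrite integral_mkcond fubini_tonelli1//; last 2 first.
- apply/(measurable_restrictT _ mS)/measurable_EFinP.
  by apply: measurable_funS measurable_invr2 => //; [exact: measurable_axb|exact: slab_axb].
- apply: erestrict_ge0 => z /slab_axb z0; rewrite lee_fin invr_ge0; exact: ltW.
have E x : fubini_F lebesgue_R ((fun z : 'rV[R]_d * R => (z.2^-1)%:E) \_ (slab c h t s)) x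
    = ((2 * s)%:E * (\1_(box c h) x)%:E)%E.
  rewrite /fubini_F indicE.
  have [xb|xb] := boolP (x \in box c h).
    rewrite mule1 (_ : 2 * s = (t + s) - (t - s)); last by ring.
    rewrite -integral_inv_expR; last lra.
    rewrite [RHS]integral_mkcond; apply: eq_integral => y _.
    rewrite !patchE; congr (if _ then _ else _).
    by apply/idP/idP; rewrite !inE /slab/=; rewrite inE in xb; [case|split].
  rewrite mule0; apply: integral0_eq => y _; rewrite patchE.
  by case: ifPn => //; rewrite inE => -[/= /mem_set]; rewrite (negbTE xb).
rewrite (eq_integral (fun x => (2 * s)%:E * (\1_(box c h) x)%:E)%E) => [|x _]; last exact: E.
have mB := measurable_box c h.
rewrite ge0_integralZl//; last 2 first.
- exact/measurable_EFinP.
- by rewrite lee_fin mulr_ge0.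
rewrite integral_indic// setIT [in RHS]mulrC [RHS]EFinM.
congr (_ * _)%E; exact: lebesgue_box.
Qed.

End slab.

(** * Partitions up to a null set *)

Section ae_partition.
Context d (T : measurableType d) (R : realType)
  (mu : {measure set T -> \bar R}) (J : finType).

(** The open pieces miss their common faces. Requiring them to exhaust the measure rather than the
    set spares a description of these faces; if [A] has finite measure, what is missed is null. *)
Definition ae_partition (A : set T) (B : J -> set T) :=
  [/\ forall j, measurable (B j), forall j, B j `<=` A,
    forall i j, i != j -> B i `&` B j = set0 &
    mu A = (\sum_(j : J) mu (B j))%E].

Variables (A : set T) (B : J -> set T).
Hypothesis mA : measurable A.
Hypothesis A_fin : (mu A < +oo)%E.
Hypothesis AB : ae_partition A B.

Let U := \big[setU/set0]_(j <- index_enum J) B j.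

Let tB : trivIset [set` index_enum J] B.
Proof. by have [_ _ + _] := AB; move=> dB; apply/trivIsetP => i j _ _; exact: dB. Qed.

Let mB j : measurable (B j). Proof. by have [] := AB. Qed.

Let mU : measurable U. Proof. exact: bigsetU_measurable. Qed.

Let UA : U `<=` A.
Proof. by move=> x; rewrite /U -bigcup_seq => -[j _]; have [_ BA _ _] := AB; exact: BA. Qed.

Let AUA : A `\` (A `\` U) = U. Proof. by rewrite setDD; exact/setIidr. Qed.

Let null : mu (A `\` U) = 0%E.
Proof.
have muU : mu U = mu A.
  rewrite -[LHS]mul1e -integral_cst// /U ge0_integral_bigsetU//=; last first.
    exact: index_enum_uniq.
  by have [_ _ _ ->] := AB; apply: eq_bigr => j _; rewrite integral_cst ?mul1e.
rewrite measureD// setIidr// [X in (_ - X)%E]muU subee//.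
by rewrite ge0_fin_numE.
Qed.

Lemma ae_partition_ge0_integral (g : T -> \bar R) : measurable_fun A g ->
  (forall x, A x -> (0 <= g x)%E) ->
  (\int[mu]_(x in A) g x = \sum_(j : J) \int[mu]_(x in B j) g x)%E.
Proof.
move=> mg g0.
rewrite (@ge0_negligible_integral _ _ _ mu A (A `\` U))// ?AUA; last exact: measurableD.
rewrite ge0_integral_bigsetU//.
- exact: index_enum_uniq.
- exact: measurable_funS mg.
- by move=> x /UA; exact: g0.
Qed.

Lemma ae_partition_Rintegral (u : T -> R) : mu.-integrable A (EFin \o u) ->
  \int[mu]_(x in A) u x = \sum_(j : J) \int[mu]_(x in B j) u x.
Proof.
move=> iu; rewrite /Rintegral.
rewrite (@negligible_integral _ _ _ mu A (A `\` U))// ?AUA; last exact: measurableD.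
rewrite integral_bigsetU_EFin//; last 2 first.
- exact: index_enum_uniq.
- by move: iu => /measurable_int; apply: measurable_funS.
rewrite sum_fine// => j _; apply: integrable_fin_num => //.
by apply: integrableS iu => //; have [] := AB.
Qed.

End ae_partition.

(** * Halving cubes and intervals *)

Section slab_partition.
Context {R : realType} {d : nat}.
Implicit Types (c : 'I_d -> R) (h t s : R).

Local Notation haar := (right_haar : {measure set ('rV[R]_d * R) -> \bar R}).

(** Displacement of the centre when an interval of half-length [h] is replaced by its upper or lower
    half. *)
Definition half_shift h (b : bool) : R := if b then h / 2 else - (h / 2).

Lemma half_shift_sub h (x y : R) b : `|x - (y + half_shift h b)| < h / 2 ->
  `|x - y| < h.
Proof. by case: b => /=; rewrite !ltr_norml => /andP[h1 h2]; lra. Qed.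

Lemma half_shift_disj h (x y : R) b b' : `|x - (y + half_shift h b)| < h / 2 ->
  `|x - (y + half_shift h b')| < h / 2 -> b = b'.
Proof.
by case: b; case: b' => //=; rewrite !ltr_norml => /andP[h1 h2] /andP[h3 h4]; lra.
Qed.

Lemma ae_partition_slab_box c h t s : 0 <= h -> 0 <= s ->
  ae_partition haar (slab c h t s)
    (fun e : {ffun 'I_d -> bool} => slab (fun i => c i + half_shift h (e i)) (h / 2) t s).
Proof.
move=> h0 s0; split.
- by move=> e; exact: measurable_slab.
- by move=> e [x a] [/= xe ?]; split => //= i; exact: half_shift_sub (xe i).
- move=> e e' ee'; apply/seteqP; split => // -[x a] [[/= xe _] [xe' _]].
  move/eqP : ee'; apply; apply/ffunP => i.
  exact: half_shift_disj (xe i) (xe' i).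
- rewrite haar_slab//; under eq_bigr do rewrite haar_slab ?divr_ge0//.
  rewrite sumEFin sumr_const card_ffun card_bool card_ord; congr EFin; rewrite -[RHS]mulr_natl.
  rewrite natrX [RHS]mulrA -exprMn; congr (_ ^+ _ * _); first by field.
Qed.

Lemma ae_partition_slab_itv c h t s : 0 <= h -> 0 <= s ->
  ae_partition haar (slab c h t s)
    (fun b : bool => slab c h (t + half_shift s b) (s / 2)).
Proof.
(* In [ln a] the interval is symmetric about its centre, so the [half_shift] lemmas apply as for
   cubes. *)
have itvE u v (a : R) : `]expR (u - v), expR (u + v)[%classic a <-> 0 < a /\ `|ln a - u| < v.
  rewrite /= in_itv/=; split.
    move=> /andP[h1 h2]; have a0 : 0 < a by rewrite (lt_trans _ h1)// expR_gt0.
    split => //; rewrite ltr_norml.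
    move: h1 h2; rewrite -{1 2}(lnK a0) !ltr_expR; lra.
  move=> [a0]; rewrite ltr_norml => h1; rewrite -(lnK a0) !ltr_expR.
  by move: h1; lra.
move=> h0 s0; split.
- by move=> e; exact: measurable_slab.
- move=> e [x a] [xc] /= /itvE[a0 ae]; split => //=; apply/itvE; split => //.
  exact: half_shift_sub ae.
- move=> e e' /eqP ee'; apply/seteqP; split => // -[x a] [[/= _ /itvE[_ ae]] [_ /itvE[_ ae']]].
  exact: ee' (half_shift_disj ae ae').
- rewrite haar_slab//; under eq_bigr do rewrite haar_slab ?divr_ge0//.
  rewrite sumEFin big_bool/=; congr EFin; first by field.
Qed.

End slab_partition.

(** Take [G] as the sigma-algebra of a second measurable space on the same carrier: the identity
    from it is measurable because its coordinates are. *)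
Lemma generated_by_coordinates (R : realType) (d : nat)
    (G : set (set ('rV[R]_d * R))) : sigma_algebra setT G ->
  (forall i c, G [set z : 'rV[R]_d * R | z.1 ord0 i < c]) ->
  (forall c, G [set z : 'rV[R]_d * R | z.2 < c]) -> measurable `<=` G.
Proof.
move=> sG G1 G2.
have mT (u : g_sigma_algebraType G -> R) :
    (forall c, G [set z | u z < c]) -> measurable_fun setT u.
  move=> Gu; apply: (measurability _ (RGenInftyO.measurableE R)) => // _ [_ [c ->] <-].
  rewrite setTI (_ : u @^-1` _ = [set z | u z < c]).
    by apply: sub_sigma_algebra; apply: Gu.
  by apply/seteqP; split => z /=; rewrite in_itv.
have mid : measurable_fun setT
    (fun z : g_sigma_algebraType G => (z : 'rV[R]_d * R)).
  rewrite (_ : (fun z => _) =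
      fun z : g_sigma_algebraType G => ((z : 'rV[R]_d * R).1, (z : 'rV[R]_d * R).2)).
    apply: measurable_fun_pair; last exact: mT.
    by apply: measurable_fun_rV => i; exact: mT.
  by apply/funext => -[].
move=> A mA; have := mid measurableT A mA; rewrite setTI.
by rewrite -[X in _ -> X A](sigma_algebra_id sG).
Qed.

(** * The bounds on the side of the cube *)

Section side_bounds.
Context {R : realType} (beta : R).
Hypothesis beta_gt : 1 + ln 2 < beta.

(* In the coordinates [t = ln a0], [s = ln r], admissibility of the side [X]
   reads [lo_side t s <= X < up_side t s]. *)
Definition lo_side (t s : R) : R :=
  expR (t / 2) * (if 1 <= s then expR (beta * s) else s).

Definition up_side (t s : R) : R :=
  expR (t / 2) * (if 1 <= s then expR (4 * beta * s) else expR (4 * beta) * s).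

Let ln2_gt0 : 0 < ln 2 :> R. Proof. by apply: ln_gt0; rewrite ltr1n. Qed.

Let beta_gt1 : 1 < beta. Proof. by move: ln2_gt0 beta_gt; lra. Qed.

Let expR_ln2 : expR (ln 2) = 2 :> R. Proof. by rewrite lnK// posrE. Qed.

(** Moving the centre costs at most a factor e^(s/4) in e^(t/2). Passing from s to s / 2 gains more:
    e^(beta s/2) for long intervals, and 2 for short ones. *)
Lemma lo_side_half t s b : 0 < s ->
  lo_side (t + half_shift s b) (s / 2) <= lo_side t s.
Proof.
move=> s0; have bs : 0 <= (beta - 1) * s by rewrite mulr_ge0 ?subr_ge0 ?ltW.
apply: (@le_trans _ _ (expR (t / 2) *
    (expR (s / 4) * (if 1 <= s / 2 then expR (beta * (s / 2)) else s / 2)))).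
  rewrite mulrA -expRD ler_wpM2r//.
    by case: ifP => // _; lra.
  by rewrite ler_expR; case: b => /=; lra.
rewrite ler_pM2l ?expR_gt0//; have [s1|s1] := leP 1 (s / 2).
  rewrite ifT; last lra.
  by rewrite -expRD ler_expR; move: bs; lra.
have [s2|s2] := leP 1 s.
  by rewrite -[leRHS]mulr1; apply: ler_pM; rewrite ?expR_ge0 ?ler_expR//; lra.
have h : 3 / 4 <= expR (- (s / 4)).
  by apply: le_trans (expR_ge1Dx _); lra.
have : expR (s / 4) <= 2.
  rewrite -[s / 4]opprK expRN invf_ple ?posrE ?expR_gt0//; lra.
by move=> h2; rewrite [leRHS](_ : s = 2 * (s / 2)) ?ler_pM2r; [|lra..].
Qed.

(** If the cube cannot be halved, its side is below twice the lower bound; this keeps it below the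
    upper bound of the halved interval. The ln 2 in [beta_gt] pays for the factor 2. *)
Lemma up_side_half t s b : 0 < s ->
  2 * lo_side t s <= up_side (t + half_shift s b) (s / 2).
Proof.
move=> s0; have bs : 0 <= (beta - 1 - ln 2) * s by apply: mulr_ge0; move: s0 beta_gt; lra.
have ls : ln 2 * 0 <= ln 2 * s by rewrite ler_pM2l// ltW.
apply: (@le_trans _ _ (expR (t / 2) * (expR (- (s / 4)) *
    (if 1 <= s / 2 then expR (4 * beta * (s / 2)) else expR (4 * beta) * (s / 2))))).
  rewrite mulrCA ler_pM2l ?expR_gt0// -{1}expR_ln2.
  have [s1|s1] := leP 1 (s / 2).
    rewrite ifT; last lra.
    have ls2 : ln 2 * 2 <= ln 2 * s by rewrite ler_pM2l//; lra.
    by rewrite -!expRD ler_expR; move: bs; lra.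
  (* For 1 <= s < 2 the formulas mix: exponential at [s], linear at [s / 2], where s / 2 is at least
     e^(- ln 2). *)
  have [s2|s2] := leP 1 s.
    apply: (@le_trans _ _ (expR (- (s / 4)) * (expR (4 * beta) * expR (- ln 2)))).
      have bs2 : 0 <= (beta - 1 - ln 2) * (2 - s) by rewrite mulr_ge0//; move: beta_gt; lra.
      have ls2 : ln 2 * s <= ln 2 * 2 by rewrite ler_pM2l//; lra.
      by rewrite -!expRD ler_expR; move: bs2 beta_gt ln2_gt0; lra.
    rewrite !ler_pM2l ?expR_gt0// expRN expR_ln2; lra.
  have h4 : 4 <= expR (- (s / 4)) * expR (4 * beta).
    rewrite [leLHS](_ : _ = expR (ln 2) * expR (ln 2)); last by rewrite expR_ln2 -natrM.
    by rewrite -!expRD ler_expR; move: beta_gt ln2_gt0; lra.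
  rewrite expR_ln2 (_ : 2 * s = 4 * (s / 2)); last by field.
  by rewrite [leRHS]mulrA ler_pM2r// divr_gt0.
rewrite mulrA -expRD ler_wpM2r//.
  by case: ifP => _; rewrite ?mulr_ge0 ?expR_ge0//; lra.
by rewrite ler_expR; case: b => /=; lra.
Qed.

(** Together with [up_side_le] this makes, in both regimes, an admissible side comparable to e^(t/2)
    s as long as [s] is bounded. *)
Lemma le_lo_side t s : 0 < s -> expR (t / 2) * s <= lo_side t s.
Proof.
move=> s0; rewrite /lo_side ler_pM2l ?expR_gt0//; case: ifP => // _.
apply: le_trans (expR_ge1Dx _); have : 0 <= (beta - 1) * s.
  by rewrite mulr_ge0 ?subr_ge0 ?ltW.
lra.
Qed.

Lemma up_side_le t s : 0 < s ->
  up_side t s <= expR (t / 2) * (expR (4 * beta * (1 + s)) * s).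
Proof.
move=> s0; rewrite /up_side ler_pM2l ?expR_gt0//.
have bs : 0 <= beta * s by rewrite mulr_ge0 ?(ltW s0) ?(le_trans ler01) ?ltW.
have [s1|s1] := leP 1 s; last by rewrite ler_pM2r// ler_expR; lra.
rewrite -[leLHS]mulr1; apply: ler_pM; rewrite ?expR_ge0 ?ler_expR//.
by have := beta_gt1; lra.
Qed.

End side_bounds.

(** * Admissible sets in logarithmic coordinates *)

Section admissible_sets.
Context {R : realType} {d : nat} (beta : R).
Implicit Types (k : int) (m : 'I_d -> int) (t s : R) (A : set ('rV[R]_d * R)).

Local Notation haar := (right_haar : {measure set ('rV[R]_d * R) -> \bar R}).

Definition cube_center k m (i : 'I_d) : R := ((m i)%:~R + 2^-1) * 2 ^ k.

Lemma cube_box k m : cube k m = box (cube_center k m) (2 ^ k / 2).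
Proof.
apply/seteqP; split => x /= hx i; have := hx i; rewrite /cube_center ltr_norml;
  move=> /andP[h1 h2]; apply/andP; split; lra.
Qed.

Lemma side_exprE k t s :
  (if expR 1 <= expR s
   then Num.sqrt (expR t) * expR s `^ beta <= (2 : R) ^ k
          < Num.sqrt (expR t) * expR s `^ (4 * beta)
   else Num.sqrt (expR t) * ln (expR s) <= (2 : R) ^ k
          < expR (4 * beta) * Num.sqrt (expR t) * ln (expR s)) =
  (lo_side beta t s <= (2 : R) ^ k < up_side beta t s).
Proof.
rewrite -powR12_sqrt ?expR_ge0// -!expRM ler_expR expRK /lo_side /up_side.
rewrite [expR (4 * beta) * _]mulrC.
by case: ifP => _; rewrite ?[s * _]mulrC ?mulrA.
Qed.

Lemma admissibleP A : admissible beta A <-> exists k m t s,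
  [/\ 0 < s, A = slab (cube_center k m) (2 ^ k / 2) t s &
    lo_side beta t s <= (2 : R) ^ k < up_side beta t s].
Proof.
split.
  move=> [k [m [a0 [r [a0_gt0 r1 -> hk]]]]].
  have r0 : 0 < r by exact: lt_trans r1.
  exists k, m, (ln a0), (ln r); rewrite -side_exprE !lnK ?posrE//; split => //.
    by rewrite ln_gt0.
  by rewrite /slab cube_box expRB expRD !lnK ?posrE.
move=> [k [m [t [s [s0 -> hk]]]]].
exists k, m, (expR t), (expR s); rewrite side_exprE expR_gt0; split => //.
  by rewrite expR_gt1.
by rewrite /slab cube_box expRB expRD.
Qed.

Hypothesis beta_gt : 1 + ln 2 < beta.

Let exprz2_gt0 k : 0 < (2 : R) ^ k. Proof. exact: exprz_gt0. Qed.

Lemma measurable_admissible A : admissible beta A -> measurable A.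
Proof. by move=> /admissibleP[k [m [t [s [_ -> _]]]]]; exact: measurable_slab. Qed.

Lemma haar_admissible_gt0 A : admissible beta A -> (0 < haar A)%E.
Proof.
move=> /admissibleP[k [m [t [s [s0 -> _]]]]].
by rewrite haar_slab ?ltW ?divr_gt0// lte_fin mulr_gt0 ?exprn_gt0 ?mulr_gt0 ?divr_gt0.
Qed.

Lemma haar_admissible_fin A : admissible beta A -> (haar A < +oo)%E.
Proof.
move=> /admissibleP[k [m [t [s [s0 -> _]]]]].
by rewrite haar_slab ?ltW ?divr_gt0// ltry.
Qed.

Lemma exprz2_pred k : (2 : R) ^ (k - 1) = 2 ^ k / 2.
Proof. by rewrite expfzDr// exprN1. Qed.

(* Halve the cube when its side leaves room above the lower bound, and the
   interval otherwise. *)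
Lemma admissible_split A : (0 < d)%N -> admissible beta A ->
  exists (J : finType) (B : J -> set ('rV[R]_d * R)),
    [/\ ae_partition haar A B, forall j, admissible beta (B j),
      forall j, vol haar (B j) <= vol haar A / 2 &
      forall j, vol haar A <= 2 ^+ d * vol haar (B j)].
Proof.
move=> d0 /admissibleP[k [m [t [s [s0 -> /andP[lok upk]]]]]].
have k0 := exprz2_gt0 k.
have h0 : 0 <= (2 : R) ^ k / 2 by rewrite divr_ge0 ?ltW.
have h02 : 0 <= (2 : R) ^ k / 2 / 2 by rewrite divr_ge0.
have s2 : 0 <= s / 2 by rewrite divr_ge0 ?ltW.
(* Halving the interval only costs a factor 2; bounding it by 2^d gives one constant for both kinds
   of splitting. *)
have d2 : (2 : R) <= 2 ^+ d by rewrite -[leLHS]expr1 ler_weXn2l// ler1n.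
have [half|half] := leP (lo_side beta t s) (2 ^ (k - 1)).
  exists {ffun 'I_d -> bool}, (fun e : {ffun 'I_d -> bool} =>
    slab (fun i => cube_center k m i + half_shift (2 ^ k / 2) (e i)) (2 ^ k / 2 / 2) t s).
  have volE (e : {ffun 'I_d -> bool}) : vol haar (slab (cube_center k m) (2 ^ k / 2) t s) = 2 ^+ d *
      vol haar (slab (fun i => cube_center k m i + half_shift (2 ^ k / 2) (e i)) (2 ^ k / 2 / 2) t s).
    rewrite /vol !haar_slab ?(ltW s0)//= [RHS]mulrA -exprMn; congr (_ ^+ _ * _).
    by field.
  split.
  - by apply: ae_partition_slab_box => //; exact: ltW.
  (* Doubling [m i] expresses the lower corner in units of the halved side; adding 1 selects the
     upper half. *)
  - move=> e; apply/admissibleP; exists (k - 1), (fun i => m i *+ 2 + (e i : nat)%:Z), t, s.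
    split => //; last by rewrite half exprz2_pred (lt_trans _ upk)// ltr_pdivrMr// ltr_pMr// ltr1n.
    rewrite exprz2_pred; congr slab; apply/funext => i; rewrite /cube_center exprz2_pred.
    by rewrite intrD rmorphMn/= -pmulrn; case: (e i) => /=; field.
  - move=> e; rewrite (volE e) ler_pdivlMr// mulrC ler_wpM2r//.
    by rewrite fine_ge0.
  - by move=> e; rewrite -volE.
exists bool, (fun b => slab (cube_center k m) (2 ^ k / 2) (t + half_shift s b) (s / 2)).
have volE b : vol haar (slab (cube_center k m) (2 ^ k / 2) t s) =
    2 * vol haar (slab (cube_center k m) (2 ^ k / 2) (t + half_shift s b) (s / 2)).
  by rewrite /vol !haar_slab ?(ltW s0)//=; field.
split.
- by apply: ae_partition_slab_itv => //; exact: ltW.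
- move=> b; apply/admissibleP; exists k, m, (t + half_shift s b), (s / 2).
  split => //; first by rewrite divr_gt0.
  rewrite (le_trans (lo_side_half beta_gt t b s0) lok)/=.
  (* [half] puts 2^k below twice the old lower bound. *)
  apply: lt_le_trans (up_side_half beta_gt t b s0).
  by move: half; rewrite exprz2_pred ltr_pdivrMr// mulrC.
- by move=> b; rewrite (volE b) mulrAC divff// mul1r.
- by move=> b; rewrite (volE b) ler_wpM2r// fine_ge0.
Qed.

End admissible_sets.

(** * The John-Nirenberg inequality on admissible sets *)

Section haar_john_nirenberg.
Context {R : realType} {d : nat} (beta : R).
Hypothesis beta_gt : 1 + ln 2 < beta.
Implicit Types (A B : set ('rV[R]_d * R)).

Local Notation haar := (right_haar : {measure set ('rV[R]_d * R) -> \bar R}).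

Lemma slab_subset_center (c c' : 'I_d -> R) (h h' t t' s s' : R) : 0 < h' -> 0 < s' ->
  slab c' h' t' s' `<=` slab c h t s -> `|t' - t| < s /\ s' < 4 * s.
Proof.
move=> h0 s0 sub.
have tin u : `|u - t'| < s' -> `|u - t| < s.
  rewrite !ltr_norml => us.
  have : slab c' h' t' s' (\row_i c' i, expR u).
    split => /= [i|]; first by rewrite mxE subrr normr0.
    by rewrite in_itv/= !ltr_expR; move: us; lra.
  by move=> /sub[_]; rewrite /= in_itv/= !ltr_expR; lra.
split; first by apply: tin; rewrite subrr normr0.
have : `|t' + s' / 2 - t| < s by apply: tin; rewrite ltr_norml; lra.
have : `|t' - s' / 2 - t| < s by apply: tin; rewrite ltr_norml; lra.
by rewrite !ltr_norml; lra.
Qed.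

Lemma expR_itv_dist (t s a b : R) : 0 < s ->
  `]expR (t - s), expR (t + s)[%classic a ->
  `]expR (t - s), expR (t + s)[%classic b ->
  `|a - b| <= expR (t + s) * (2 * s).
Proof.
move=> s0; rewrite /= !in_itv/= => ha hb.
suff : expR (t + s) - expR (t - s) <= expR (t + s) * (2 * s).
  by move: ha hb; rewrite ler_norml; lra.
rewrite (_ : t - s = (t + s) + - (2 * s)); last by ring.
rewrite [X in _ - X]expRD -[X in X - _]mulr1 -mulrBr ler_pM2l ?expR_gt0//.
have := expR_ge1Dx (- (2 * s)); lra.
Qed.

(** Inside [A] the parameters t' and s' of [B] are bounded, so the side condition gives X <= C1 s'
    and s' <= C2 X. The measure 2 X^d s' is then at least 2 X^(d+1) / C1, and its smallness forces
    that of both X and s'. *)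
Lemma admissible_small A : admissible beta A -> forall e, 0 < e ->
  exists2 eta, 0 < eta & forall B, admissible beta B -> B `<=` A ->
    vol haar B <= eta -> forall x y, B x -> B y ->
    (forall i, `|x.1 ord0 i - y.1 ord0 i| <= e) /\ `|x.2 - y.2| <= e.
Proof.
move=> /admissibleP[k [m [t [s [s0 -> _]]]]] e e0.
(* [C1] and [C2] come from [up_side_le] and [le_lo_side] with t - s < t' < t + s and s' < 4s;
   [C3 * X] bounds the length of the interval in [a]. *)
pose C1 := expR ((t + s) / 2) * expR (4 * beta * (1 + 4 * s)).
pose C2 := expR (- ((t - s) / 2)).
pose C3 := expR (t + 5 * s) * 2 * C2.
have C1_gt0 : 0 < C1 by rewrite mulr_gt0 ?expR_gt0.
have C3_gt0 : 0 < C3 by rewrite !mulr_gt0 ?expR_gt0.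
have C31 : 0 < 1 + C3 by rewrite addr_gt0.
(* Small enough for the cube, [dlt <= e], and for the interval, [C3 * dlt <= e]. *)
pose dlt := e / (1 + C3).
have dlt0 : 0 < dlt by rewrite divr_gt0.
have dlte : dlt <= e by rewrite ler_pdivrMr// ler_peMr ?(ltW e0)// lerDl ltW.
have C3dlt : C3 * dlt <= e.
  by rewrite mulrCA ler_piMr ?(ltW e0)// ler_pdivrMr// mul1r lerDr.
exists (dlt ^+ d.+1 / C1); first by rewrite divr_gt0// exprn_gt0.
move=> _ /admissibleP[k' [m' [t' [s' [s'0 -> /andP[loX Xup]]]]]].
set X := (2 : R) ^ k' in loX Xup *.
have X0 : 0 < X by exact: exprz_gt0.
move=> sub; have X2 : 0 < X / 2 by rewrite divr_gt0.
have [tt' ss'] := slab_subset_center X2 s'0 sub.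
have {tt'} : t - s < t' /\ t' < t + s by move: tt'; rewrite ltr_norml; lra.
move=> [tt1 tt2]; rewrite /vol haar_slab ?(ltW X2) ?(ltW s'0)//= => small.
have beta0 : 0 < beta.
  by apply: lt_trans beta_gt; rewrite addr_gt0// ln_gt0// ltr1n.
have XC1 : X <= C1 * s'.
  apply: (le_trans (ltW Xup)); apply: (le_trans (up_side_le beta_gt t' s'0)).
  rewrite mulrA ler_pM2r// /C1 ler_pM ?expR_ge0// ler_expR; first lra.
  by rewrite ler_pM2l ?mulr_gt0//; lra.
have XC2 : s' <= C2 * X.
  have := le_trans (le_lo_side beta_gt t' s'0) loX.
  rewrite -ler_pdivlMl ?expR_gt0// => /le_trans; apply.
  by rewrite ler_pM2r// -expRN ler_expR; lra.
have Xdlt : X <= dlt.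
  rewrite leNgt; apply/negP => dltX.
  move: small; apply/negP; rewrite -ltNge ltr_pdivrMr// -mulrA.
  rewrite (_ : 2 * (X / 2) = X); last by field.
  rewrite exprSr; apply: (@le_lt_trans _ _ (X ^+ d * dlt)).
    by rewrite ler_pM2r// lerXn2r// ?nnegrE// ltW.
  rewrite ltr_pM2l ?exprn_gt0//; apply: (lt_le_trans dltX).
  by have : 0 < C1 * s' by [rewrite mulr_gt0]; move: XC1; lra.
move=> x y [xc xt] [yc yt]; split.
  move=> i; have := xc i; have := yc i; rewrite !ltr_norml ler_norml.
  by move: Xdlt dlte; lra.
apply: (le_trans (expR_itv_dist s'0 xt yt)); apply: le_trans C3dlt.
apply: (@le_trans _ _ (C3 * X)); last by rewrite ler_pM2l.
rewrite /C3 -!mulrA ler_pM ?expR_ge0 ?mulr_ge0 ?(ltW s'0)//.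
  by rewrite ler_expR; lra.
by rewrite ler_pM2l.
Qed.

Hypothesis d_gt0 : (0 < d)%N.

Lemma haar_john_nirenberg (p : R) : 1 <= p -> exists2 C : R, 0 <= C &
  forall f : 'rV[R]_d * R -> R,
    (forall A, admissible beta A -> haar.-integrable A (EFin \o f)) ->
    forall b, 0 < b ->
    (forall A, admissible beta A -> dev haar A f (mean haar A f) <= b * vol haar A) ->
    forall A, admissible beta A ->
    (\int[haar]_(x in A) (`|f x - mean haar A f| `^ p)%:E <= (C * b `^ p * vol haar A)%:E)%E.
Proof.
move=> p1.
(* The abstract argument takes a splitting defined on every set; sets that are not admissible
   receive themselves as a default. *)
have /choice[w wP] A : exists w : {J : finType & J -> set ('rV[R]_d * R)},
    admissible beta A -> let B := projT2 w in
    [/\ ae_partition haar A B, forall j, admissible beta (B j),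
      forall j, vol haar (B j) <= vol haar A / 2 &
      forall j, vol haar A <= 2 ^+ d * vol haar (B j)].
  have [adA|nA] := pselect (admissible beta A); last by exists (existT (fun J : finType => J -> set (_ * R)%type) unit (fun=> A)).
  by have [J [B HB]] := admissible_split beta_gt d_gt0 adA; exists (existT (fun J : finType => J -> set (_ * R)%type) J B).
set J := fun A => projT1 (w A); set F : forall A, J A -> _ := fun A => projT2 (w A).
pose phi (i : option 'I_d) (z : 'rV[R]_d * R) :=
  if i is Some j then z.1 ord0 j else z.2.
(* The constant of [john_nirenberg] with D = 2^d, as supplied by [admissible_split]. *)
exists (2 * 2 `^ p * (2 * 2 `^ p) `^ p + (2 ^+ d * (2 * 2 `^ p)) `^ p).
  by rewrite addr_ge0 ?mulr_ge0 ?powR_ge0.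
move=> f f_int b b0 f_bmo A adA.
apply: (@john_nirenberg _ _ R haar (admissible beta) J F _ _ _ _ _ _ _ _ phi) => //.
- exact: measurable_admissible.
- exact: haar_admissible_gt0.
- exact: haar_admissible_fin.
- by move=> B j /wP[_ + _ _]; exact.
- by move=> B j /wP[[_ + _ _] _ _ _]; exact.
- by move=> B j /wP[_ _ + _]; exact.
- move=> B u adB; apply: ae_partition_Rintegral.
  + exact: measurable_admissible adB.
  + exact: haar_admissible_fin adB.
  + by have [] := wP B adB.
- case=> [i|] /=; last exact: measurable_snd.
  exact: (measurableT_comp (measurable_coord i) measurable_fst).
- move=> B i adB e e0; have [eta eta0 small] := admissible_small adB e0.
  exists eta => // B' adB' B'B B'eta x y B'x B'y.
  have [h1 h2] := small B' adB' B'B B'eta x y B'x B'y.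
  by case: i.
- move=> G sG Gphi; apply: generated_by_coordinates => // [i c|c].
    exact: (Gphi (Some i)).
  exact: (Gphi None).
- by move=> B j /wP[_ _ _ +]; exact.
Qed.

End haar_john_nirenberg.

(* Unlike [ge0_subset_integral], this needs no measurability: compact sets in
   [Lp_loc] are not known to be measurable. *)
Lemma ge0_integral_subset d (T : measurableType d) (R : realType)
    (mu : {measure set T -> \bar R}) (A B : set T) (g : T -> \bar R) :
  A `<=` B -> (forall x, (0 <= g x)%E) ->
  (\int[mu]_(x in A) g x <= \int[mu]_(x in B) g x)%E.
Proof.
move=> AB g0; rewrite !ge0_integralE//; apply: le_ereal_sup => _ [h hA <-].
exists h => // x; apply: (le_trans (hA x)); rewrite !patchE.
by case: ifPn => [/set_mem/AB/mem_set ->//|_]; case: ifPn.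
Qed.

Lemma ge0_integral_le_scaledD d (T : measurableType d) (R : realType)
    (mu : {measure set T -> \bar R}) (A : set T) (k : R) (g u v : T -> R) :
  measurable A -> measurable_fun A g -> measurable_fun A u -> measurable_fun A v ->
  0 <= k -> (forall x, 0 <= g x) -> (forall x, 0 <= u x) -> (forall x, 0 <= v x) ->
  (forall x, g x <= k * (u x + v x)) ->
  (\int[mu]_(x in A) (g x)%:E <=
    k%:E * (\int[mu]_(x in A) (u x)%:E + \int[mu]_(x in A) (v x)%:E))%E.
Proof.
move=> mA /measurable_EFinP mg /measurable_EFinP mu_ /measurable_EFinP mv.
move=> k0 g0 u0 v0 guv.
have muv := emeasurable_funD mu_ mv.
rewrite -ge0_integralD; [|by []|by move=> x _; rewrite lee_fin|by []
  |by move=> x _; rewrite lee_fin|by []].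
rewrite -ge0_integralZl; [|by []|by []
  |by move=> x _; rewrite -EFinD lee_fin addr_ge0|by rewrite lee_fin].
apply: ge0_le_integral; [by []|by move=> x _; rewrite lee_fin|by []| |].
- exact: emeasurable_funM (measurable_cst _) muv.
- by move=> x _; rewrite -EFinD -EFinM lee_fin.
Qed.

(** * Compact sets and slabs *)

Section local_integrability.
Context {R : realType} {d : nat}.
Implicit Types (K : set ('rV[R]_d * R)).

Local Notation haar := (right_haar : {measure set ('rV[R]_d * R) -> \bar R}).

Lemma slab_sub_compact (c : 'I_d -> R) (h t s : R) :
  exists K, [/\ K `<=` axb, compact K & slab c h t s `<=` K].
Proof.
exists ([set x : 'rV[R]_d | forall i, `[c i - h, c i + h]%classic (x ord0 i)] `*`
  `[expR (t - s), expR (t + s)]); split.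
- move=> z [_ /=]; rewrite in_itv/= => /andP[+ _].
  by apply: lt_le_trans; exact: expR_gt0.
- apply: compact_setX; last exact: segment_compact.
  by apply: (@rV_compact R d (fun i => `[c i - h, c i + h]%classic)) => i; exact: segment_compact.
- move=> z [zc zt]; split => /= [i|]; last exact: subset_itv_oo_cc zt.
  by have := zc i; rewrite in_itv/= ltr_norml; lra.
Qed.

(** [ln] is continuous on [K], which lies in the half-space a > 0; the bound on [ln a] keeps [K]
    away from a = 0. *)
Lemma compact_bounds K : compact K -> K `<=` axb -> exists M : R,
  forall z, K z -> (forall i, `|z.1 ord0 i| <= M) /\ `|ln z.2| <= M.
Proof.
move=> cK Kaxb.
have [M1 [_ K1]] := compact_bounded cK.
have cln : compact ((fun z : 'rV[R]_d * R => ln z.2) @` K).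
  apply: continuous_compact => //; apply: continuous_in_subspaceT => z /set_mem Kz.
  apply: continuous_comp; first exact: cvg_snd.
  apply: continuous_ln; exact: Kaxb.
have [M2 [_ K2]] := compact_bounded cln.
exists (Num.max (M1 + 1) (M2 + 1)) => z Kz; split; last first.
  rewrite le_max; apply/orP; right; apply: K2; first by rewrite ltrDl.
  by exists z.
move=> i; rewrite le_max; apply/orP; left.
apply: (@le_trans _ _ `|z|); last by apply: K1 => //; rewrite ltrDl.
rewrite prod_normE le_max; apply/orP; left.
rewrite [leRHS]/Num.Def.normr/= mx_normrE.
exact: (@le_bigmax _ _ _ 0 (fun ij : 'I_1 * 'I_d => `|z.1 ij.1 ij.2|) (ord0, i)).
Qed.

(** No dyadic cube has the origin in its interior. The slab is therefore centred there with
    half-side 2^k, twice the admissible size, so that its 2^d orthants are admissible. *)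
Lemma compact_sub_slab (beta : R) K : 1 + ln 2 < beta -> compact K -> K `<=` axb ->
  exists (k : int) s, [/\ 0 < s, K `<=` slab (fun=> 0) (2 ^ k) 0 s &
    lo_side beta 0 s <= 2 ^ k < up_side beta 0 s].
Proof.
move=> beta_gt cK Kaxb; have [M KM] := compact_bounds cK Kaxb.
have L0 : 0 < ln 2 :> R by apply: ln_gt0; rewrite ltr1n.
have b0 : 0 < beta by apply: lt_trans beta_gt; rewrite addr_gt0.
have bL : 0 < beta / ln 2 by rewrite divr_gt0.
have : \forall n \near \oo, exists (k : int) s, [/\ 0 < s, K `<=` slab (fun=> 0) (2 ^ k) 0 s &
    lo_side beta 0 s <= 2 ^ k < up_side beta 0 s].
  near=> n.
  have n1 : M <= n%:R by near: n; exact: nbhs_infty_ger.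
  have n2 : (`|M| + 1) * (beta / ln 2) <= n%:R by near: n; exact: nbhs_infty_ger.
  (* Makes e^(beta s) = 2^n, so that the side 2^n meets the lower bound exactly. *)
  pose s := n%:R * ln 2 / beta.
  have sM : `|M| + 1 <= s by rewrite ler_pdivlMr// -ler_pdivrMr// -mulrA.
  have M0 := normr_ge0 M; have MM := ler_norm M.
  have s1 : 1 <= s by lra.
  have n2n : n%:R < (2 : R) ^+ n by rewrite -natrX ltr_nat ltn_expl.
  exists n, s; split; first lra.
    move=> z Kz; have [z1 z2] := KM z Kz; split => /= [i|].
      by rewrite subr0 (le_lt_trans (z1 i))// (le_lt_trans n1).
    have z0 : 0 < z.2 by exact: Kaxb.
    by move: z2; rewrite in_itv/= -(lnK z0) !ltr_expR expRK ler_norml; lra.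
  rewrite /lo_side /up_side s1 mul0r expR0 !mul1r.
  have sE : beta * s = n%:R * ln 2 by rewrite /s; field; rewrite gt_eqF.
  have s0 : 0 < beta * s by rewrite mulr_gt0// (lt_le_trans ltr01).
  have E : expR (beta * s) = (2 : R) ^ n by rewrite sE expRM_natl lnK ?posrE// exprnP.
  by rewrite -E lexx/= ltr_expR -mulrA ltr_pMl ?ltr1n.
by case=> n _ /(_ n (leqnn n)).
Unshelve. all: by end_near. Qed.

End local_integrability.

(** * The modulus and the real and imaginary parts *)

Section complex_modulus.
Context {R : realType}.
Implicit Types z w : R[i].

Local Notation normc := Normc.normc.

Lemma normcE z : normc z = Num.sqrt (complex.Re z ^+ 2 + complex.Im z ^+ 2).
Proof. by case: z. Qed.

Lemma normc_ge0 z : 0 <= normc z.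
Proof. by rewrite normcE sqrtr_ge0. Qed.

Lemma ReB z w : complex.Re (z - w) = complex.Re z - complex.Re w.
Proof. by case: z => a b; case: w. Qed.

Lemma ImB z w : complex.Im (z - w) = complex.Im z - complex.Im w.
Proof. by case: z => a b; case: w. Qed.

Lemma Re_le_normc z : `|complex.Re z| <= normc z.
Proof. by rewrite normcE -sqrtr_sqr ler_wsqrtr// lerDl sqr_ge0. Qed.

Lemma Im_le_normc z : `|complex.Im z| <= normc z.
Proof. by rewrite normcE -sqrtr_sqr ler_wsqrtr// lerDr sqr_ge0. Qed.

Lemma normc_le z : normc z <= `|complex.Re z| + `|complex.Im z|.
Proof.
rewrite normcE -[leRHS]ger0_norm ?addr_ge0// -sqrtr_sqr ler_wsqrtr//.
by rewrite sqrrD !real_normK ?num_real// lerD2r lerDl mulrn_wge0// mulr_ge0.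
Qed.

End complex_modulus.

(** * Comparison of the seminorms *)

Section bmo.
Context {R : realType} {d : nat} (beta : R).
Hypothesis beta_gt : 1 + ln 2 < beta.
Implicit Types (A K : set ('rV[R]_d * R)) (f : 'rV[R]_d * R -> R[i]).

Local Notation haar := (right_haar : {measure set ('rV[R]_d * R) -> \bar R}).
Local Notation normc := Normc.normc.
Local Notation fRe f := (fun z => complex.Re (f z)).
Local Notation fIm f := (fun z => complex.Im (f z)).

Definition power_dev (p : R) f A (a : R[i]) : \bar R :=
  (\int[haar]_(z in A) (normc (f z - a) `^ p)%:E)%E.

Lemma power_dev_ge0 p f A a : (0 <= power_dev p f A a)%E.
Proof. by apply: integral_ge0 => z _; rewrite lee_fin powR_ge0. Qed.

Lemma measurable_normc_powR f p A a : measurable_cplx f -> A `<=` axb -> measurable A ->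
  measurable_fun A (fun z => normc (f z - a) `^ p).
Proof.
move=> [mRe mIm] Aaxb mA; apply: (measurableT_comp (measurable_powR p)).
under eq_fun do rewrite normcE ReB ImB.
apply: measurableT_comp.
  by apply: continuous_measurable_fun; exact: sqrt_continuous.
apply: measurable_funD; apply: measurable_funX; apply: measurable_funB => //.
  by apply: measurable_funS mRe => //; exact: measurable_axb.
by apply: measurable_funS mIm => //; exact: measurable_axb.
Qed.

Lemma admissible_axb A : admissible beta A -> A `<=` axb.
Proof. by move=> /admissibleP[k [m [t [s [_ -> _]]]]]; exact: slab_axb. Qed.

Lemma Lp_loc_slab p f c h t s : Lp_loc p f -> (power_dev p f (slab c h t s) 0%R < +oo)%E.
Proof.
move=> [mf fK]; have [K [Kaxb cK sK]] := slab_sub_compact c h t s.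
apply: le_lt_trans (fK K Kaxb cK); rewrite /power_dev.
under eq_integral do rewrite subr0.
by apply: ge0_integral_subset => // z; rewrite lee_fin powR_ge0.
Qed.

(** A pointwise substitute for Hölder's inequality: if y > x, then y = y^(1-p) y^p, and t^(1-p) is
    nonincreasing in t. *)
Lemma powR_ge_linear (p : R) (x y : R) : 1 <= p -> 0 < x -> 0 <= y ->
  y <= x + x `^ (1 - p) * y `^ p.
Proof.
move=> p1 x0 y0; have [yx|xy] := leP y x.
  by rewrite (le_trans yx)// lerDl mulr_ge0 ?powR_ge0.
rewrite -[leLHS]add0r lerD ?(ltW x0)//.
have y_gt0 := lt_trans x0 xy.
apply: (@le_trans _ _ (y `^ (1 - p) * y `^ p)).
  by rewrite -powRD ?subrK ?powRr1// gt_eqF// implybT.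
rewrite ler_wpM2r ?powR_ge0// -(opprB p) !powRN lef_pV2 ?posrE ?powR_gt0//.
by apply: ge0_ler_powR; rewrite ?subr_ge0// ?nnegrE ltW.
Qed.

Lemma Lp_loc_1 p f : 1 <= p -> Lp_loc p f -> Lp_loc 1 f.
Proof.
move=> p1 locf; have mf := locf.1; split => // K Kaxb cK.
have [k [s [s0 Ks _]]] := compact_sub_slab beta_gt cK Kaxb.
set S := slab _ _ _ _ in Ks; have mS : measurable S := measurable_slab _ _ _ _.
apply: (@le_lt_trans _ _ (power_dev 1 f S 0)).
  rewrite /power_dev; under [leRHS]eq_integral do rewrite subr0.
  by apply: ge0_integral_subset => // z; rewrite lee_fin powR_ge0.
apply: (@le_lt_trans _ _ (\int[haar]_(z in S) (1 + (normc (f z - 0) `^ p)%:E))%E).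
  have mn q := measurable_normc_powR q 0 mf (@slab_axb _ _ (fun=> 0) (2 ^ k) 0 s) mS.
  apply: ge0_le_integral => //.
  - by move=> z _; rewrite lee_fin powR_ge0.
  - exact/measurable_EFinP.
  - by apply: emeasurable_funD => //; exact/measurable_EFinP.
  - move=> z _; rewrite -EFinD lee_fin powRr1 ?normc_ge0//.
    by have := powR_ge_linear p1 ltr01 (normc_ge0 (f z - 0)); rewrite powR1 mul1r.
rewrite ge0_integralD//; last 2 first.
- by move=> z _; rewrite lee_fin powR_ge0.
- apply/measurable_EFinP; apply: measurable_normc_powR => //; exact: slab_axb.
rewrite integral_cst// mul1e lte_add_pinfty//; last exact: Lp_loc_slab.
by rewrite haar_slab ?ltry// ltW// exprz_gt0.
Qed.

Lemma oscillation_leP p f A B : 1 <= p -> admissible beta A -> 0 <= B ->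
  (oscillation p f A <= B%:E)%E <->
  (power_dev p f A (average f A) <= (B `^ p * vol haar A)%:E)%E.
Proof.
move=> p1 adA B0; have p0 : 0 < p by exact: lt_le_trans p1.
have v0 : 0 < vol haar A.
  exact: (vol_gt0 (haar_admissible_gt0 adA) (haar_admissible_fin adA)).
rewrite -[oscillation p f A]/(((vol haar A)^-1%:E * power_dev p f A (average f A)) `^ p^-1)%E.
move: (power_dev_ge0 p f A (average f A)).
case: (power_dev p f A (average f A)) => [r| |//].
  rewrite lee_fin => r0; rewrite -EFinM poweR_EFin !lee_fin.
  have r'0 : 0 <= (vol haar A)^-1 * r by rewrite mulr_ge0// invr_ge0 ltW.
  rewrite -ler_pdivrMr// [r / _]mulrC; split => h.
    have := @ge0_ler_powR R p (ltW p0) (((vol haar A)^-1 * r) `^ p^-1) B.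
    rewrite !nnegrE powR_ge0 => /(_ isT B0 h).
    by rewrite -powRrM mulVf ?gt_eqF// powRr1.
  have ip0 : 0 <= p^-1 by rewrite invr_ge0 ltW.
  have := ge0_ler_powR ip0 r'0 (powR_ge0 B p) h.
  by rewrite -powRrM mulfV ?gt_eqF// powRr1.
(* If the integral is infinite, both inequalities fail. *)
move=> _; rewrite gt0_muley ?lte_fin ?invr_gt0//.
  by rewrite poweRyr// gt_eqF// invr_gt0.
Qed.

Lemma bmo_seminorm_leP p f B : 1 <= p -> 0 <= B ->
  (bmo_seminorm beta p f <= B%:E)%E <-> forall A, admissible beta A ->
  (power_dev p f A (average f A) <= (B `^ p * vol haar A)%:E)%E.
Proof.
move=> p1 B0; split => [h A adA|h].
  apply/oscillation_leP => //; apply: le_trans h.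
  by apply: ereal_sup_ubound; exists A.
by apply: ge_ereal_sup => _ [A adA <-]; apply/oscillation_leP => //; exact: h.
Qed.

(** Indices 0 and -1 give the dyadic cubes having the origin as a vertex. *)
Lemma admissible_orthant k s (e : {ffun 'I_d -> bool}) : 0 < s ->
  lo_side beta 0 s <= (2 : R) ^ k < up_side beta 0 s ->
  admissible beta (slab (fun i => 0 + half_shift (2 ^ k) (e i)) (2 ^ k / 2) 0 s).
Proof.
move=> s0 hk; apply/admissibleP; exists k, (fun i => if e i then 0 else -1), 0, s.
split => //; congr slab; apply/funext => i; rewrite /cube_center /half_shift.
by case: (e i); field.
Qed.

(** A supremum over the empty family would be -oo, so an admissible set is needed; enclosing the
    empty compact set yields one. *)
Lemma bmo_seminorm_ge0 p f : (0 <= bmo_seminorm beta p f)%E.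
Proof.
have [k [s [s0 _ hk]]] := @compact_sub_slab R d beta set0 beta_gt (@compact0 _) (@sub0set _ _).
have adA := admissible_orthant [ffun=> true] s0 hk.
set A := slab _ _ _ _ in adA.
apply: (@le_trans _ _ (oscillation p f A)); first exact: poweR_ge0.
by apply: ereal_sup_ubound; exists A.
Qed.

(** Integrate [powR_ge_linear] at x = t: each of its two terms contributes at most [t] per unit of
    volume. *)
Lemma bmo1_le p f t : 1 <= p -> measurable_cplx f -> 0 < t ->
  (bmo_seminorm beta p f <= t%:E)%E -> (bmo_seminorm beta 1 f <= (2 * t)%:E)%E.
Proof.
move=> p1 mf t0 /bmo_seminorm_leP-/(_ p1 (ltW t0)) h.
apply/bmo_seminorm_leP => //; first by rewrite mulr_ge0// ltW.
move=> A adA; have mA := measurable_admissible adA; have Aaxb := admissible_axb adA.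
rewrite powRr1 ?mulr_ge0 ?(ltW t0)//.
have mn q := measurable_normc_powR q (average f A) mf Aaxb mA.
have hA := volE (haar_admissible_fin adA).
apply: (@le_trans _ _ (\int[haar]_(z in A)
    (t%:E + (t `^ (1 - p))%:E * (normc (f z - average f A) `^ p)%:E))%E).
  apply: ge0_le_integral => //.
  - by move=> z _; rewrite lee_fin powR_ge0.
  - exact/measurable_EFinP.
  - apply: emeasurable_funD => //; apply: emeasurable_funM => //.
    exact/measurable_EFinP.
  - move=> z _; rewrite -EFinM -EFinD lee_fin powRr1 ?normc_ge0//.
    exact: powR_ge_linear (normc_ge0 _).
rewrite ge0_integralD//; last 3 first.
- by move=> z _; rewrite lee_fin ltW.
- by move=> z _; rewrite -EFinM lee_fin mulr_ge0 ?powR_ge0.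
- by apply: emeasurable_funM => //; exact/measurable_EFinP.
rewrite ge0_integralZl//; last 3 first.
- exact/measurable_EFinP.
- by move=> z _; rewrite lee_fin powR_ge0.
- by rewrite lee_fin powR_ge0.
rewrite integral_cst// [X in (t%:E * X)%E]hA.
apply: (@le_trans _ _ ((t * vol haar A)%:E + ((t `^ (1 - p)) * (t `^ p * vol haar A))%:E)%E).
  by rewrite leeD2l// EFinM lee_wpmul2l ?lee_fin ?powR_ge0//; exact: h.
rewrite -EFinD lee_fin mulrA -powRD; last by rewrite (gt_eqF t0) implybT.
by rewrite subrK powRr1 ?(ltW t0)//; lra.
Qed.

Lemma normc_powR_le p (z w : R[i]) : 1 <= p ->
  normc z `^ p <= 2 `^ p * (normc (z - w) `^ p + normc w `^ p).
Proof.
move=> p1; apply: le_trans (powRD_le p1 (normc_ge0 _) (normc_ge0 _)).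
apply: ge0_ler_powR; rewrite ?nnegrE ?addr_ge0 ?normc_ge0 ?(le_trans ler01)//.
by rewrite -[in leLHS](subrK w z) le_normcD.
Qed.

Lemma power_dev_fin p f A a : 1 <= p -> measurable_cplx f -> admissible beta A ->
  (power_dev p f A a < +oo)%E -> (power_dev p f A 0%R < +oo)%E.
Proof.
move=> p1 mf adA fin.
have mA := measurable_admissible adA; have Aaxb := admissible_axb adA.
have mn b := measurable_normc_powR p b mf Aaxb mA.
apply: (@le_lt_trans _ _ ((2 `^ p)%:E *
    (power_dev p f A a + \int[haar]_(z in A) (normc a `^ p)%:E))%E).
  apply: ge0_integral_le_scaledD mA (mn _) (mn _) _ _ _ _ _ _.
  - exact: measurable_cst.
  - exact: powR_ge0.
  - by move=> z; exact: powR_ge0.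
  - by move=> z; exact: powR_ge0.
  - by move=> z; exact: powR_ge0.
  - by move=> z; rewrite subr0; exact: normc_powR_le.
have A_fin := haar_admissible_fin adA.
apply: lte_mul_pinfty; [by rewrite lee_fin powR_ge0|by []|].
apply: lte_add_pinfty; first exact: fin.
rewrite integral_cst; last exact: mA.
by apply: lte_mul_pinfty; [rewrite lee_fin powR_ge0|by []|exact: A_fin].
Qed.

(** On an admissible set, of finite measure, a finite p-th power deviation makes |f|^p integrable;
    the orthants of a slab around [K] then add up. Hence a finite seminorm alone makes a measurable
    function locally p-integrable. *)
Lemma Lp_loc_of_bmo p f t : 1 <= p -> 0 <= t -> measurable_cplx f ->
  (bmo_seminorm beta p f <= t%:E)%E -> Lp_loc p f.
Proof.
move=> p1 t0 mf /bmo_seminorm_leP-/(_ p1 t0) h; split => // K Kaxb cK.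
have [k [s [s0 Ks hk]]] := compact_sub_slab beta_gt cK Kaxb.
have k0 : 0 < (2 : R) ^ k by exact: exprz_gt0.
set S := slab _ _ _ _ in Ks; have mS : measurable S := measurable_slab _ _ _ _.
apply: (@le_lt_trans _ _ (power_dev p f S 0%R)).
  rewrite /power_dev; under [leRHS]eq_integral do rewrite subr0.
  by apply: ge0_integral_subset => // z; rewrite lee_fin powR_ge0.
have S_fin : (haar S < +oo)%E by rewrite haar_slab ?ltry// ltW.
have part := ae_partition_slab_box (fun _ : 'I_d => 0) 0 (ltW k0) (ltW s0).
rewrite /power_dev (ae_partition_ge0_integral mS S_fin part); last 2 first.
- by apply/measurable_EFinP; apply: measurable_normc_powR => //; exact: slab_axb.
- by move=> z _; rewrite lee_fin powR_ge0.
apply: lte_sum_pinfty => e _; have adA := admissible_orthant e s0 hk.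
apply: power_dev_fin => //; apply: le_lt_trans (h _ adA) _; exact: ltry.
Qed.

Lemma integrable_component f (g : 'rV[R]_d * R -> R) A : Lp_loc 1 f ->
  measurable_fun axb g -> (forall z, `|g z| <= normc (f z)) ->
  admissible beta A -> haar.-integrable A (EFin \o g).
Proof.
move=> locf mg gf adA; have mA := measurable_admissible adA.
have Aaxb := admissible_axb adA.
have mgA : measurable_fun A g.
  by apply: measurable_funS mg => //; exact: measurable_axb.
apply/integrableP; split; first exact/measurable_EFinP.
apply: (@le_lt_trans _ _ (power_dev 1 f A 0%R)).
  apply: ge0_le_integral => //.
  - by apply: measurableT_comp => //; exact/measurable_EFinP.
  - by apply/measurable_EFinP; apply: measurable_normc_powR => //; exact: locf.1.
  - by move=> z _; rewrite lee_fin subr0 powRr1 ?normc_ge0.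
by move: adA => /admissibleP[k [m [t [s [_ -> _]]]]]; exact: Lp_loc_slab.
Qed.

Hypothesis d_gt0 : (0 < d)%N.

(** The means of the real and imaginary parts are the components of [average f A], so both parts
    inherit the bound [t] and the real inequality applies to each. *)
Lemma bmo_le_bmo1 p : 1 <= p -> exists2 C : R, 0 < C & forall f t, Lp_loc 1 f -> 0 < t ->
  (bmo_seminorm beta 1 f <= t%:E)%E -> (bmo_seminorm beta p f <= (C * t)%:E)%E.
Proof.
move=> p1; have p0 : 0 < p by exact: lt_le_trans p1.
have [C0 C0_ge0 jn] := haar_john_nirenberg beta_gt d_gt0 p1.
(* Two parts with constant [C0] each, times the 2^p of [powRD_le]; the [+ 1] keeps [D] positive. *)
pose D := 2 `^ p * (2 * C0) + 1.
have D0 : 0 < D by rewrite ltr_pwDr// !mulr_ge0// powR_ge0.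
exists (D `^ p^-1); first exact: powR_gt0.
move=> f t locf t0 /(bmo_seminorm_leP _ (lexx 1) (ltW t0)) h.
have mf := locf.1.
have iRe A : admissible beta A -> haar.-integrable A (EFin \o fRe f).
  exact: (integrable_component locf mf.1 (fun z => Re_le_normc (f z))).
have iIm A : admissible beta A -> haar.-integrable A (EFin \o fIm f).
  exact: (integrable_component locf mf.2 (fun z => Im_le_normc (f z))).
have dev_le (g : 'rV[R]_d * R -> R) A c : haar.-integrable A (EFin \o g) ->
    (forall z, `|g z - c| <= normc (f z - average f A)) -> admissible beta A ->
    dev haar A g c <= t * vol haar A.
  move=> ig gf adA; have mA := measurable_admissible adA.
  have idev := integrableR_dev c mA (haar_admissible_fin adA) ig.
  rewrite -lee_fin /dev /Rintegral fineK; last exact: integrable_fin_num.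
  have := h A adA; rewrite powRr1 ?(ltW t0)//; apply: le_trans.
  apply: ge0_le_integral => //.
  - by move: idev => /measurable_int.
  - apply/measurable_EFinP; apply: measurable_normc_powR => //; exact: admissible_axb adA.
  - by move=> z _; rewrite lee_fin powRr1 ?normc_ge0.
have devRe A : admissible beta A ->
    dev haar A (fRe f) (mean haar A (fRe f)) <= t * vol haar A.
  move=> adA; apply: dev_le => //; first exact: iRe.
  by move=> z; have := Re_le_normc (f z - average f A); rewrite ReB.
have devIm A : admissible beta A ->
    dev haar A (fIm f) (mean haar A (fIm f)) <= t * vol haar A.
  move=> adA; apply: dev_le => //; first exact: iIm.
  by move=> z; have := Im_le_normc (f z - average f A); rewrite ImB.
apply/bmo_seminorm_leP => //; first by rewrite mulr_ge0 ?powR_ge0 ?ltW.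
move=> A adA; have mA := measurable_admissible adA; have Aaxb := admissible_axb adA.
have jnRe := jn _ iRe _ t0 devRe A adA.
have jnIm := jn _ iIm _ t0 devIm A adA.
have mdev (g : 'rV[R]_d * R -> R) c : measurable_fun axb g ->
    measurable_fun A (fun z => `|g z - c| `^ p).
  move=> mg; apply: (measurableT_comp (measurable_powR p)); apply: measurableT_comp => //.
  apply: measurable_funB => //; apply: measurable_funS mg => //; exact: measurable_axb.
have mRe := mdev _ (mean haar A (fRe f)) mf.1.
have mIm := mdev _ (mean haar A (fIm f)) mf.2.
apply: (@le_trans _ _ ((2 `^ p)%:E *
    (\int[haar]_(z in A) (`|fRe f z - mean haar A (fRe f)| `^ p)%:E +
     \int[haar]_(z in A) (`|fIm f z - mean haar A (fIm f)| `^ p)%:E))%E).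
  have mn := measurable_normc_powR p (average f A) mf Aaxb mA.
  apply: ge0_integral_le_scaledD mA mn mRe mIm _ _ _ _ _.
  - exact: powR_ge0.
  - by move=> z; exact: powR_ge0.
  - by move=> z; exact: powR_ge0.
  - by move=> z; exact: powR_ge0.
  - move=> z; apply: le_trans (powRD_le p1 (normr_ge0 _) (normr_ge0 _)).
    apply: ge0_ler_powR; rewrite ?nnegrE ?addr_ge0 ?normc_ge0 ?(ltW p0)//.
    by have := normc_le (f z - average f A); rewrite ReB ImB.
apply: le_trans (lee_wpmul2l _ (leeD jnRe jnIm)) _; first by rewrite lee_fin powR_ge0.
rewrite -EFinD -EFinM lee_fin powRM ?powR_ge0 ?(ltW t0)//.
rewrite -powRrM mulVf ?gt_eqF// powRr1 ?(ltW D0)// /D.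
have : 0 <= t `^ p * vol haar A by rewrite mulr_ge0 ?powR_ge0// fine_ge0.
lra.
Qed.

End bmo.

(** * Equivalence of the norms *)

(** Taking t = x + e / C with [e] tending to 0 also covers x = 0, which is not itself an allowed
    [t]. *)
Lemma le_scaled_of_bounds (R : realType) (C : R) (x y : \bar R) : 0 < C ->
  (0 <= x)%E -> (forall t : R, 0 < t -> (x <= t%:E)%E -> (y <= (C * t)%:E)%E) ->
  (y <= C%:E * x)%E.
Proof.
move=> C0; case: x => [x|_ _|//]; last by rewrite gt0_muley ?lte_fin// leey.
rewrite lee_fin => x0 h; apply/lee_addgt0Pr => e e0.
rewrite -EFinM -EFinD (_ : C * x + e = C * (x + e / C)).
  by apply: h; rewrite ?lee_fin ?lerDl ?ltr_wpDl ?divr_ge0 ?divr_gt0// ltW.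
by field; rewrite gt_eqF.
Qed.

Theorem corollary3p29 (R : realType) (d : nat) (hd : (1 <= d)%N)
    (beta : R) (hbeta : 1 + ln 2 < beta) (p : R) (hp : 1 <= p) :
  BMO d beta p = BMO d beta 1 /\
  exists c C : R, 0 < c /\ 0 < C /\
    forall F, BMO d beta 1 F ->
      (c%:E * bmo_norm beta 1 F <= bmo_norm beta p F
        <= C%:E * bmo_norm beta 1 F)%E.
Proof.
have [C C0 upper] := bmo_le_bmo1 hbeta hd hp.
have upperE (f : 'rV[R]_d * R -> R[i]) : Lp_loc 1 f ->
    (bmo_seminorm beta p f <= C%:E * bmo_seminorm beta 1 f)%E.
  move=> locf; apply: le_scaled_of_bounds => //; first exact: bmo_seminorm_ge0.
  by move=> t t0; exact: upper.
have lowerE (f : 'rV[R]_d * R -> R[i]) : measurable_cplx f ->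
    (bmo_seminorm beta 1 f <= 2%:E * bmo_seminorm beta p f)%E.
  move=> mf; apply: le_scaled_of_bounds => //; first exact: bmo_seminorm_ge0.
  by move=> t t0; exact: bmo1_le.
split.
  apply/seteqP; split => F [locF finF]; have mF := locF.1.
    split; first exact: (Lp_loc_1 hbeta hp).
    by apply: le_lt_trans (lowerE _ mF) _; rewrite lte_mul_pinfty.
  (* Settled before membership in [Lp_loc p], which is deduced from it. *)
  have finp : (bmo_norm beta p F < +oo)%E.
    by apply: le_lt_trans (upperE _ locF) _; rewrite lte_mul_pinfty// lee_fin ltW.
  split; last exact: finp.
  apply: (Lp_loc_of_bmo hbeta hp (t := fine (bmo_norm beta p F))); last 2 first.
  - exact: mF.
  - by rewrite fineK// ge0_fin_numE// bmo_seminorm_ge0.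
  by rewrite fine_ge0// bmo_seminorm_ge0.
(* The inverse of the factor 2 in [bmo1_le]. *)
exists 2^-1, C; split; first by rewrite invr_gt0.
split => // F [locF _]; apply/andP; split; last exact: upperE.
apply: le_trans (lee_wpmul2l _ (lowerE _ locF.1)) _; first by rewrite lee_fin invr_ge0.
by rewrite muleA -EFinM mulVf// mul1e.
Qed.
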